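(* Let $\{\kappa'_n\}_{n\ge1}$ be the infinitesimal free cumulants of the limit infinitesimal distribution of the GOE. Then $\kappa'_n=1$ for every even $n\ge2$.
   Context: GOE: $X_N=\frac{1}{\sqrt{2N}}(G+G^{t})$ where $G=(g_{ij})_{i,j=1}^N$ has independent identically distributed real $\mathcal{N}(0,1)$ entries. With $\mathrm{tr}=\frac1N\mathrm{Tr}$, the limits $m_n=\lim_{N}\mathrm{E}(\mathrm{tr}(X_N^n))$ and $m'_n=\lim_{N}N(\mathrm{E}(\mathrm{tr}(X_N^n))-m_n)$ exist for all $n\geq 1$ and are the moments and infinitesimal moments of the GOE ($m_n$ are the moments of the semi-circle law on $[-2,2]$). With $NC(n)$ the non-crossing partitions of $\{1,\dots,n\}$, the free cumulants $\kappa_n$ and the infinitesimal free cumulants $\kappa'_n$ are the unique sequences such that for all $n\ge1$ $$m_n=\sum_{\pi\in NC(n)}\ \prod_{V\in\pi}\kappa_{|V|},\qquad m'_n=\sum_{\pi\in NC(n)}\ \sum_{V\in\pi}\kappa'_{|V|}\prod_{W\in\pi,\,W\neq V}\kappa_{|W|}.$$ *)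

(* Defs.v *)
From HB Require Import structures.
From mathcomp Require Import all_boot all_order all_algebra.
From mathcomp Require Import all_classical all_reals all_analysis.

Set Implicit Arguments.
Unset Strict Implicit.
Unset Printing Implicit Defensive.

Import Order.TTheory GRing.Theory Num.Theory.
Import numFieldNormedType.Exports.

Local Open Scope classical_set_scope.
Local Open Scope ring_scope.

Definition noncrossing (n : nat) (p : {set {set 'I_n}}) : bool :=
  [forall V in p, forall W in p, (V != W) ==>
    ~~ [exists i in V, exists j in W, exists k in V, exists l in W,
          (i < j < k)%N && (k < l)%N]].

Definition NC (n : nat) : {set {set {set 'I_n}}} :=
  [set p : {set {set 'I_n}} | finset.partition p [set: 'I_n]%SET & noncrossing p]%SET.

(* Values at index 0 are irrelevant: only n >= 1 is constrained and the blocks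
   of a partition are nonempty. *)
Definition free_cumulants (R : realType) (m kappa : nat -> R) : Prop :=
  forall n : nat, (0 < n)%N ->
    m n = \sum_(p in NC n) \prod_(V in p) kappa #|V|.

Definition infinitesimal_free_cumulants (R : realType)
    (m' kappa kappa' : nat -> R) : Prop :=
  forall n : nat, (0 < n)%N ->
    m' n = \sum_(p in NC n) \sum_(V in p)
             kappa' #|V| * \prod_(W in p | W != V) kappa #|W|.

Definition mutually_independent (d : measure_display) (T : measurableType d)
    (R : realType) (P : probability T R) (I : finType)
    (X : I -> {RV P >-> R}) : Prop :=
  forall (J : {set I}) (B : I -> set R), (forall i, measurable (B i)) ->
    P [set w | forall i, i \in J -> B i (X i w)] =
    (\prod_(i in J) P (X i @^-1` B i))%E.

(* The laws are compared on Borel sets only: a pushforward and [normal_prob]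
   may differ as set functions on non-measurable sets. *)
Definition standard_normal (d : measure_display) (T : measurableType d)
    (R : realType) (P : probability T R) (X : {RV P >-> R}) : Prop :=
  forall B : set R, measurable B -> distribution P X B = normal_prob 0 1 B.

Definition iid_standard_normal_entries (d : measure_display)
    (T : measurableType d) (R : realType) (P : probability T R) (N : nat)
    (G : 'I_N -> 'I_N -> {RV P >-> R}) : Prop :=
  mutually_independent (fun ij : 'I_N * 'I_N => G ij.1 ij.2) /\
  forall i j, standard_normal (G i j).

Definition goe_matrix (d : measure_display) (T : measurableType d)
    (R : realType) (P : probability T R) (N : nat)
    (G : 'I_N -> 'I_N -> {RV P >-> R}) (w : T) : 'M[R]_N :=
  let A := \matrix_(i, j) G i j w in
  (Num.sqrt (2 * N%:R))^-1 *: (A + A^T).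

Definition normalized_trace (R : realType) (N : nat) (A : 'M[R]_N) : R :=
  N%:R^-1 * \tr A.

Definition goe_mean_trace (d : measure_display) (T : measurableType d)
    (R : realType) (P : probability T R) (N : nat)
    (G : 'I_N -> 'I_N -> {RV P >-> R}) (n : nat) : R :=
  fine ('E_P[fun w => normalized_trace (goe_matrix G w ^+ n)])%E.

Definition goe_moment (R : realType) (d : nat -> measure_display)
    (T : forall N, measurableType (d N)) (P : forall N, probability (T N) R)
    (G : forall N, 'I_N -> 'I_N -> {RV (P N) >-> R}) (n : nat) : R :=
  limn (fun N => goe_mean_trace (G N) n).

Definition goe_inf_moment (R : realType) (d : nat -> measure_display)
    (T : forall N, measurableType (d N)) (P : forall N, probability (T N) R)
    (G : forall N, 'I_N -> 'I_N -> {RV (P N) >-> R}) (n : nat) : R :=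
  limn (fun N => N%:R * (goe_mean_trace (G N) n - goe_moment G n)).

(* Main.v *)
(* Gaussian integration by parts gives the loop equation of the GOE,
     E (tr X^(n+1) T) = sum_(k < n) E (tr X^k tr X^(n-1-k) T)
                        + n / N E (tr X^(n-1) T) + O(1 / N^2)
   for every product of traces T.  Hence mixed moments of traces factorise up to
   O(1 / N^2), and E (tr X^n) = c_n + v_n / N + O(1 / N^2), where the generating
   series C and V of c and v satisfy C = 1 + t^2 C^2 and
   V = 2 t^2 C V + t^2 (t C)'.

   Splitting a non-crossing partition at the second element of the block of its
   first point gives, for the series Z_j in which that block counts j additional
   elements, Z_j = kappa_j + t Z_0 Z_(j+1).  Over R[eps]/(eps^2) this treats the
   cumulants and the infinitesimal cumulants at once.  Cumulants are determined by
   moments, so it suffices to see that kappa = delta_2 and kappa' = the indicator of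
   the even positive integers yield c and v; this reduces to (t C)' (2 - C) = C^2,
   which follows from the quadratic equation by differentiation. *)
Require Import Defs.
From HB Require Import structures.
From mathcomp Require Import all_boot all_order all_algebra.
From mathcomp Require Import all_classical all_reals all_analysis.
From mathcomp Require Import measurable_realfun zify ring.

Set Implicit Arguments.
Unset Strict Implicit.
Unset Printing Implicit Defensive.
Import Order.TTheory GRing.Theory Num.Theory.
Import numFieldNormedType.Exports.
Local Open Scope ring_scope.

(** * Non-crossing partitions *)

(** The loop equation does not close on single traces: splitting one trace produces two. Hence the
    estimates concern all lists of exponents at once. The term of order 1 / N reflects the symmetry
    of the matrix, which gives every entry a second, transposed pairing; this twisted contraction is
    what feeds V and thus the infinitesimal cumulants.

    The identity (t C)' (2 - C) = C^2 arises as follows. For kappa = delta_2 one has Z_0 = C, Z_1 =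
    t C, Z_2 = 1 and Z_j = 0 beyond. If kappa' is the indicator of the even integers, the
    infinitesimal part of Z_j for j >= 2 depends only on the parity of j: it is E for even j and O
    for odd j, with E = 1 + t C O and O = t C E. So E = 1 / (1 - t^2 C^2) = 1 / (2 - C), and
    comparing Z_0 with the equation of V leaves C^2 E = (t C)'.

    Power series appear as polynomials modulo a power of ['X], and dual numbers as polynomials of
    which only the coefficients 0 and 1 are read. Independence is given for events only, so the
    product rule for moments of unbounded variables has to be derived from it. *)

Section NoncrossingOn.
Variable n : nat.
Implicit Types (D A B V W : {set 'I_n}) (p q : {set {set 'I_n}}) (x y z : 'I_n).

Lemma partition_onP p D : reflect
  [/\ finset.set0 \notin p, forall V z, V \in p -> z \in V -> z \in D,
      forall z, z \in D -> exists2 V, V \in p & z \in V &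
      forall V W z, V \in p -> W \in p -> z \in V -> z \in W -> V = W]
  (finset.partition p D).
Proof.
apply: (iffP idP) => [pD|[p0 pS pC pU]].
  have [/eqP covD /finset.trivIsetP trivp p0] := and3P pD; split=> //.
  - by move=> V z Vp zV; rewrite -covD; apply/finset.bigcupP; exists V.
  - by move=> z; rewrite -covD => /finset.bigcupP[V Vp zV]; exists V.
  move=> V W z Vp Wp zV zW; apply/eqP/negP => /negP VW.
  by have /fintype.disjointFr -/(_ _ zV) := trivp V W Vp Wp VW; rewrite zW.
apply/and3P; split=> //.
  apply/eqP/finset.setP => z; apply/finset.bigcupP/idP => [[V Vp zV]|/pC[V Vp zV]].
    exact: pS zV.
  by exists V.
apply/finset.trivIsetP => V W Vp Wp; apply: contraNT => /fintype.pred0Pn[z /= /andP[zV zW]].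
by apply/eqP; apply: pU zV zW.
Qed.

Lemma noncrossingP p : reflect
  (forall V W i j k l, V \in p -> W \in p -> i \in V -> j \in W -> k \in V ->
     l \in W -> (i < j)%N -> (j < k)%N -> (k < l)%N -> V = W)
  (noncrossing p).
Proof.
apply: (iffP idP) => [nc V W i j k l Vp Wp iV jW kV lW ij jk kl|nc].
  move/forallP/(_ V): nc => /implyP/(_ Vp)/forallP/(_ W).
  move=> /implyP/(_ Wp) /implyP => nc; apply/eqP/negP => /negP/nc /negP; apply.
  apply/existsP; exists i; rewrite iV /=; apply/existsP; exists j; rewrite jW /=.
  apply/existsP; exists k; rewrite kV /=; apply/existsP; exists l; rewrite lW /=.
  by rewrite ij jk kl.
apply/forallP => V; apply/implyP => Vp; apply/forallP => W; apply/implyP => Wp.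
apply/implyP; apply: contraNN => /existsP[i /andP[iV /existsP[j /andP[jW]]]].
move=> /existsP[k /andP[kV /existsP[l /andP[lW /andP[/andP[ij jk] kl]]]]].
by apply/eqP; apply: (nc V W i j k l).
Qed.

Definition NCon D : {set {set {set 'I_n}}} :=
  finset.finset (fun p => finset.partition p D && noncrossing p).

Lemma in_NCon D p : (p \in NCon D) = finset.partition p D && noncrossing p.
Proof. by rewrite finset.inE. Qed.

Variable S : comNzRingType.
Implicit Types F : {set {set 'I_n}} -> S.

(** The second hypothesis forbids a point of [B] between two points of [A]. Four points alternating
    between a block inside [A] and a block inside [B] contain the pattern [A], [B], [A] whichever
    block comes first, so uniting two non-crossing partitions creates no crossing. *)
Lemma NCon_split A B F : [disjoint A & B] ->
  (forall i j k, i \in A -> j \in B -> k \in A -> (i < j)%N -> (j < k)%N -> False) ->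
  \sum_(p in NCon (A :|: B) | [forall V in p, (V \subset A) || (V \subset B)]) F p =
  \sum_(p in NCon A) \sum_(q in NCon B) F (p :|: q).
Proof.
move=> dAB AB; pose h (r : {set {set 'I_n}} * {set {set 'I_n}}) := r.1 :|: r.2.
pose h' (p : {set {set 'I_n}}) : {set {set 'I_n}} * {set {set 'I_n}} :=
  ([set V in p | V \subset A]%SET, [set V in p | V \subset B]%SET).
rewrite (reindex_onto h h') /=; last first.
  move=> p /andP[_ /forallP pAB]; apply/finset.setP => V; rewrite !finset.inE -andb_orr.
  by have := pAB V; case: (V \in p).
rewrite pair_big /=; apply: eq_bigl => -[p q] /=; rewrite /h /h' /=.
rewrite !in_NCon; apply/idP/idP.
  move=> /andP[/andP[/andP[/partition_onP[p0 pS pC pU] /noncrossingP nc] /forallP/= pAB]].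
  move=> /eqP[def_p def_q].
  have sub_p V : V \in p -> V \subset A by rewrite -def_p finset.inE => /andP[].
  have sub_q V : V \in q -> V \subset B by rewrite -def_q finset.inE => /andP[].
  have pU' V : V \in p -> V \in p :|: q by rewrite finset.inE => ->.
  have qU' V : V \in q -> V \in p :|: q by rewrite finset.inE => ->; rewrite orbT.
  apply/andP; split; apply/andP; split.
  - apply/partition_onP; split.
    + by apply: contra p0 => /pU'.
    + by move=> V z Vp zV; have /fintype.subsetP := sub_p V Vp; apply.
    + move=> z zA; have [|V] := pC z; first by rewrite finset.inE zA.
      rewrite finset.inE => /orP[Vp zV|Vq zV]; first by exists V.
      have /fintype.subsetP/(_ z zV) zB := sub_q V Vq.
      by move/fintype.disjointFr/(_ zA): dAB; rewrite zB.
    + by move=> V W z Vp Wp; apply: pU; apply: pU'.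
  - by apply/noncrossingP => V W i j k l Vp Wp; apply: nc; apply: pU'.
  - apply/partition_onP; split.
    + by apply: contra p0 => /qU'.
    + by move=> V z Vp zV; have /fintype.subsetP := sub_q V Vp; apply.
    + move=> z zB; have [|V] := pC z; first by rewrite finset.inE zB orbT.
      rewrite finset.inE => /orP[Vp zV|Vq zV]; last by exists V.
      have /fintype.subsetP/(_ z zV) zA := sub_p V Vp.
      by move/fintype.disjointFr/(_ zA): dAB; rewrite zB.
    + by move=> V W z Vp Wp; apply: pU; apply: qU'.
  - by apply/noncrossingP => V W i j k l Vp Wp; apply: nc; apply: qU'.
move=> /andP[/andP[/partition_onP[p0 pS pC pU] /noncrossingP pnc]].
move=> /andP[/partition_onP[q0 qS qC qU] /noncrossingP qnc].
have dis z : z \in A -> z \in B -> False.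
  by move=> zA zB; move/fintype.disjointFr/(_ zA): dAB; rewrite zB.
have sub_p V : V \in p -> V \subset A by move=> Vp; apply/fintype.subsetP => z; apply: pS.
have sub_q V : V \in q -> V \subset B by move=> Vp; apply/fintype.subsetP => z; apply: qS.
(* Blocks are nonempty, so none lies in both [A] and [B]; this makes [h'] recover the pair from the
   union. *)
have nsub_p V : V \in p -> ~~ (V \subset B).
  move=> Vp; have [V0|[z zV]] := finset.set_0Vmem V; first by rewrite -V0 Vp in p0.
  by apply/negP => /fintype.subsetP/(_ z zV); apply: dis; apply: pS zV.
have nsub_q V : V \in q -> ~~ (V \subset A).
  move=> Vp; have [V0|[z zV]] := finset.set_0Vmem V; first by rewrite -V0 Vp in q0.
  by apply/negP => /fintype.subsetP/(_ z zV) zA; apply: (dis z) => //; apply: qS zV.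
apply/andP; split; first (apply/andP; split; first (apply/andP; split)).
- apply/partition_onP; split.
  + by rewrite finset.inE negb_or p0.
  + by move=> V z; rewrite !finset.inE => /orP[/pS H /H->|/qS H /H->]; rewrite ?orbT.
  + move=> z; rewrite finset.inE => /orP[/pC|/qC] [V Vp zV]; exists V => //;
    by rewrite finset.inE Vp ?orbT.
  + move=> V W z; rewrite !finset.inE => /orP[] Vp /orP[] Wp zV zW.
    * exact: pU zV zW.
    * by case: (dis z); [apply: pS zV|apply: qS zW].
    * by case: (dis z); [apply: pS zW|apply: qS zV].
    * exact: qU zV zW.
- apply/noncrossingP => V W i j k l; rewrite !finset.inE.
  move=> /orP[] Vp /orP[] Wp iV jW kV lW ij jk kl.
  + by apply: (pnc V W i j k l).
  + by case: (AB i j k) => //; [apply: pS iV|apply: qS jW|apply: pS kV].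
  + by case: (AB j k l) => //; [apply: pS jW|apply: qS kV|apply: pS lW].
  + by apply: (qnc V W i j k l).
- apply/forallP => V; apply/implyP; rewrite finset.inE => /orP[/sub_p->//|/sub_q->].
  by rewrite orbT.
apply/eqP; congr pair; apply/finset.setP => V; rewrite !finset.inE.
  case: (boolP (V \in p)) => [/sub_p->//|_] /=.
  by case: (boolP (V \in q)) => [/nsub_q/negbTE->//|_] /=.
case: (boolP (V \in q)) => [/sub_q->//|_] /=; first by rewrite orbT.
by case: (boolP (V \in p)) => [/nsub_p/negbTE->//|_] /=.
Qed.

Definition glue x y (V : {set 'I_n}) : {set 'I_n} := if y \in V then x |: V else V.

(* When [x] and [y] are the two smallest points, the partitions joining them
   are obtained from those of [B] by inserting [x] into the block of [y]. *)
Lemma NCon_glue x y B F : x \notin B -> y \in B ->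
  (forall z, z \in B -> (x < z)%N) -> (forall z, z \in B -> (y <= z)%N) ->
  \sum_(q in NCon (x |: B) | y \in finset.pblock q x) F q =
  \sum_(q in NCon B) F (finset.imset (glue x y) (mem q)).
Proof.
move=> xB yB ltx ley.
pose h (q : {set {set 'I_n}}) : {set {set 'I_n}} := finset.imset (glue x y) (mem q).
pose h' (q : {set {set 'I_n}}) : {set {set 'I_n}} := finset.imset (fun V => V :\ x) (mem q).
have xy : x != y by apply: contraNneq xB => ->.
have gx V : x \notin V -> (glue x y V) :\ x = V.
  by rewrite /glue => xV; case: ifP => _; rewrite ?finset.setU1K // finset.setDE;
     apply/finset.setIidPl; apply/fintype.subsetP => z zV;
     rewrite !finset.inE; apply: contraNneq xV => <-.
have gy q V : finset.partition q (x |: B) -> y \in finset.pblock q x -> V \in q ->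
    (x \in V) = (y \in V).
  move=> /[dup] /partition_onP[p0 pS pC pU] pD yq Vq.
  have xc : x \in finset.cover q.
    by rewrite (finset.cover_partition pD) finset.inE finset.inE eqxx.
  have pq := finset.pblock_mem xc.
  apply/idP/idP => [xV|yV].
    by rewrite -(pU (finset.pblock q x) V x) // finset.mem_pblock.
  by rewrite -(pU (finset.pblock q x) V y) // finset.mem_pblock.
have hh' q V : finset.partition q (x |: B) -> y \in finset.pblock q x -> V \in q ->
    glue x y (V :\ x) = V.
  move=> pD yq Vq; rewrite /glue !finset.inE eq_sym xy /=.
  rewrite -(gy q V pD yq Vq); case: ifPn => xV; first by rewrite finset.setD1K.
  rewrite finset.setDE; apply/finset.setIidPl; apply/fintype.subsetP => z zV.
  by rewrite !finset.inE; apply: contraNneq xV => <-.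
rewrite (reindex_onto h h') /=; last first.
  move=> q /andP[]; rewrite in_NCon => /andP[pD _] yq.
  rewrite /h /h' -finset.imset_comp -[RHS]finset.imset_id.
  apply: finset.eq_in_imset => V Vq /=; exact: hh' yq Vq.
have h'h q : (forall V, V \in q -> x \notin V) -> h' (h q) = q.
  move=> xq; rewrite /h /h' -finset.imset_comp -[RHS]finset.imset_id.
  by apply: finset.eq_in_imset => V Vq /=; apply: gx (xq V Vq).
apply: eq_bigl => q; rewrite !in_NCon; apply/idP/idP.
  move=> /andP[/andP[/andP[pD /noncrossingP nc] yq] /eqP def_q].
  have xq V : V \in q -> x \notin V.
    by rewrite -def_q => /finset.imsetP[W _ ->]; rewrite !finset.inE eqxx.
  have hq V : V \in q -> glue x y V \in h q by move=> Vq; apply: finset.imset_f.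
  have sg V z : z \in V -> z \in glue x y V.
    by rewrite /glue; case: ifP => // _ zV; rewrite finset.inE zV orbT.
  have [p0 pS pC pU] := partition_onP _ _ pD.
  have ginj V W : V \in q -> W \in q -> glue x y V = glue x y W -> V = W.
    by move=> Vq Wq E; rewrite -(gx V (xq V Vq)) -(gx W (xq W Wq)) E.
  apply/andP; split; first apply/partition_onP; first split.
  - apply/negP => /[dup] q0 /hq; rewrite /glue finset.inE => h0.
    by rewrite h0 in p0.
  - move=> V z Vq zV; have := pS _ _ (hq V Vq) (sg V z zV).
    rewrite !finset.inE => /orP[/eqP zx|//].
    by move: (xq V Vq); rewrite -zx zV.
  - move=> z zB; have [|V] := pC z; first by rewrite !finset.inE zB orbT.
    move=> /finset.imsetP[W Wq ->] zW; exists W => //; move: zW.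
    rewrite /glue; case: ifP => // _; rewrite !finset.inE => /orP[/eqP zx|//].
    by rewrite -zx zB in xB.
  - move=> V W z Vq Wq zV zW; apply: ginj => //.
    by apply: (pU _ _ z); rewrite ?hq ?sg.
  apply/noncrossingP => V W i j k l Vq Wq iV jW kV lW ij jk kl.
  by apply: ginj => //; apply: (nc _ _ i j k l); rewrite ?hq ?sg.
move=> /andP[pD /noncrossingP nc]; have [p0 pS pC pU] := partition_onP _ _ pD.
have xq V : V \in q -> x \notin V by move=> Vq; apply: contra xB; apply: pS.
have [Y Yq yY] := pC y yB.
have inglue V z : V \in q -> z \in glue x y V -> z != x -> z \in V.
  by rewrite /glue; case: ifP => // _ _; rewrite !finset.inE => /orP[->|].
have xglue V : V \in q -> x \in glue x y V -> y \in V.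
  by rewrite /glue; case: ifP => // _ Vq xV; move: (xq V Vq); rewrite xV.
have pDh : finset.partition (h q) (x |: B).
  apply/partition_onP; split.
  - apply/finset.imsetP => -[V Vq]; rewrite /glue; case: ifP => [_ E|_ E].
      by have := finset.in_set0 x; rewrite E !finset.inE eqxx.
    by rewrite E Vq in p0.
  - move=> V z /finset.imsetP[W Wq ->] zW; rewrite !finset.inE.
    case: (eqVneq z x) => [zx|zx] /=; first by [].
    by apply: (pS W) => //; apply: inglue.
  - move=> z; rewrite !finset.inE => /orP[/eqP->|/pC[V Vq zV]].
      exists (glue x y Y); first exact: finset.imset_f.
      by rewrite /glue yY !finset.inE eqxx.
    exists (glue x y V); first exact: finset.imset_f.
    by rewrite /glue; case: ifP => _; rewrite ?finset.inE zV ?orbT.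
  - move=> V W z /finset.imsetP[V' Vq ->] /finset.imsetP[W' Wq ->] zV zW.
    congr glue; have [zx|zx] := eqVneq z x.
      by rewrite zx in zV zW; apply: (pU _ _ y); rewrite ?xglue.
    by apply: (pU _ _ z) => //; apply: inglue.
rewrite pDh /= h'h // eqxx andbT; apply/andP; split.
  apply/noncrossingP => V W i j k l /finset.imsetP[V' Vq ->] /finset.imsetP[W' Wq ->].
  move=> iV jW kV lW ij jk kl; congr glue.
  have ltx' z U : U \in q -> z \in glue x y U -> (x <= z)%N.
    move=> Uq zU; have [->//|zx] := eqVneq z x.
    by apply/ltnW/ltx; apply: (pS U) => //; apply: inglue.
  have jx : j != x by apply/eqP => jx; have := ltx' i _ Vq iV; rewrite leqNgt -jx ij.
  have kx : k != x by apply/eqP => kx; have := ltx' j _ Wq jW; rewrite leqNgt -kx jk.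
  have lx : l != x by apply/eqP => lx; have := ltx' k _ Vq kV; rewrite leqNgt -lx kl.
  have jW' := inglue _ _ Wq jW jx; have kV' := inglue _ _ Vq kV kx.
  have lW' := inglue _ _ Wq lW lx.
  (* Only the first point of the pattern can be [x]. Its block then contains [y], which replaces
     [x]: as [y] is least in [B], either [j = y] and the blocks share a point, or [y < j] and the
     pattern already occurs in [q]. *)
  have [ix|ix] := eqVneq i x; last first.
    by apply: (nc _ _ i j k l) => //; apply: inglue.
  rewrite ix in iV; have yV := xglue _ Vq iV.
  have [jy|jy] := eqVneq j y; first by apply: (pU _ _ y) => //; rewrite -jy.
  apply: (nc _ _ y j k l) => //.
  have := ley j (pS _ _ Wq jW'); rewrite leq_eqVlt => /orP[/eqP/val_inj yj|//].
  by rewrite yj eqxx in jy.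
have xY : x \in glue x y Y by rewrite /glue yY !finset.inE eqxx.
rewrite (finset.def_pblock _ _ xY); last first.
- exact: finset.imset_f.
- by case/and3P: pDh.
by rewrite /glue yY finset.inE yY orbT.
Qed.

End NoncrossingOn.

(** * Moment-cumulant recursion along the block of the first point *)

Section MomentCumulantRecursion.
Variables (S : comNzRingType) (kap : nat -> S).

(* [mc j n] is the weighted number of non-crossing partitions of [n] points in
   which the block of the first point counts [j] additional elements; the sum
   runs over the number [i] of points before the next element of that block. *)

Fixpoint mc_fuel (N j n : nat) : S :=
  if N is N'.+1 then
    if n is n'.+1 then \sum_(i < n'.+1) mc_fuel N' 0 i * mc_fuel N' j.+1 (n' - i)
    else kap j
  else kap j.

Definition mc (j n : nat) : S := mc_fuel n j n.

Lemma mc_fuelE N M j n : (n <= N)%N -> (n <= M)%N -> mc_fuel N j n = mc_fuel M j n.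
Proof.
elim: N M j n => [|N IH] [|M] j [|n] //= nN nM.
by apply: eq_bigr => i _; congr (_ * _); apply: IH; have := ltn_ord i; lia.
Qed.

Lemma mc0 j : mc j 0 = kap j.
Proof. by []. Qed.

Lemma mcS j n : mc j n.+1 = \sum_(i < n.+1) mc 0 i * mc j.+1 (n - i).
Proof.
rewrite /mc /=; apply: eq_bigr => i _.
by congr (_ * _); apply: mc_fuelE; have := ltn_ord i; lia.
Qed.

End MomentCumulantRecursion.

Section NoncrossingRecursion.
Variables (n : nat) (S : comNzRingType) (kap : nat -> S).
Implicit Types (D A B V W : {set 'I_n}) (p q : {set {set 'I_n}}) (x y z : 'I_n).

Definition nc_sum D : S := \sum_(p in NCon D) \prod_(V in p) kap #|V|.

Definition nc_weight_at (j : nat) x p : S :=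
  kap (j + #|finset.pblock p x|) * \prod_(V in p | V != finset.pblock p x) kap #|V|.

Definition nc_sum_at (j : nat) x D : S := \sum_(p in NCon D) nc_weight_at j x p.

Lemma pblock_unique p V x : V \in p -> x \in V ->
  (forall W, W \in p -> x \in W -> W = V) -> finset.pblock p x = V.
Proof.
move=> Vp xV pU; rewrite /finset.pblock; case: pickP => [W /andP[Wp xW]|/(_ V)] /=.
  exact: pU.
by rewrite /= Vp xV.
Qed.

Lemma pblock_partition p D x : finset.partition p D -> x \in D ->
  finset.pblock p x \in p /\ x \in finset.pblock p x.
Proof.
move=> pD xD; have xc : x \in finset.cover p by rewrite (finset.cover_partition pD).
by rewrite finset.pblock_mem // finset.mem_pblock.
Qed.

Lemma nc_sum_at0 x D : x \in D -> nc_sum D = nc_sum_at 0 x D.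
Proof.
move=> xD; apply: eq_bigr => p; rewrite in_NCon => /andP[pD _].
by rewrite (bigD1 (finset.pblock p x)) //; case: (pblock_partition pD xD).
Qed.

Lemma nc_sum_set0 : nc_sum finset.set0 = 1.
Proof.
rewrite /nc_sum (big_pred1 finset.set0) ?finset.big_set0 // => p.
rewrite in_NCon finset.partition_set0 /=; case: eqP => //= ->.
by apply/noncrossingP => V W i j k l; rewrite finset.inE.
Qed.

Lemma nc_sum_at_singleton j x D : x \in D -> (forall z, z \in D -> (x <= z)%N) ->
  \sum_(p in NCon D | finset.pblock p x == [set x]%SET) nc_weight_at j x p =
  kap j.+1 * nc_sum (D :\ x).
Proof.
move=> xD minx.
have defD : D = (D :\ x) :|: [set x]%SET by rewrite finset.setUC finset.setD1K.
transitivity (\sum_(p in NCon ((D :\ x) :|: [set x]%SET) |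
    [forall V in p, (V \subset D :\ x) || (V \subset [set x]%SET)]) nc_weight_at j x p).
  rewrite -defD; apply: eq_bigl => p; rewrite in_NCon.
  case: (boolP (finset.partition p D)) => //= pD; congr andb.
  have [_ pS _ pU] := partition_onP _ _ pD.
  have [bp xb] := pblock_partition pD xD.
  apply/eqP/forallP => [px V|/(_ (finset.pblock p x))].
    apply/implyP => Vp; case: (boolP (x \in V)) => xV.
      by rewrite (pU V (finset.pblock p x) x) // px fintype.subxx orbT.
    apply/orP; left; apply/fintype.subsetP => z zV; rewrite !finset.inE (pS V) // andbT.
    by apply: contraNneq xV => <-.
  rewrite bp /= => /orP[/fintype.subsetP/(_ x xb)|].
    by rewrite !finset.inE eqxx.
  rewrite finset.subset1 => /orP[/eqP//|/eqP b0].
  by rewrite b0 finset.inE in xb.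
rewrite NCon_split; first last.
- move=> i k l; rewrite !finset.inE => /andP[_ iD] /eqP-> _ ix _.
  by have := minx i iD; rewrite leqNgt ix.
- by rewrite fintype.disjoint_sym finset.disjoints1 !finset.inE eqxx.
rewrite /nc_sum big_distrr; apply: eq_bigr => p /= pD.
rewrite (big_pred1 [set [set x]%SET]%SET); last first.
  move=> q; rewrite in_NCon /=; apply/idP/eqP => [/andP[/partition_onP[q0 qS qC qU] _]|->].
    apply/finset.setP => V; rewrite !finset.inE.
    have V1 : V \in q -> V = [set x]%SET.
      move=> Vq; have : V \subset [set x]%SET by apply/fintype.subsetP => z /(qS _ _ Vq).
      rewrite finset.subset1 => /orP[/eqP//|/eqP V0]; by rewrite -V0 Vq in q0.
    apply/idP/eqP => [/V1//|->]; have [|W Wq xW] := qC x; first by rewrite finset.inE.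
    suff <- : W = [set x]%SET by [].
    have : W \subset [set x]%SET by apply/fintype.subsetP => z /(qS _ _ Wq).
    by rewrite finset.subset1 => /orP[/eqP//|/eqP W0]; rewrite W0 finset.inE in xW.
  apply/andP; split.
    apply/partition_onP; split.
    - rewrite finset.inE; apply/eqP => /finset.setP/(_ x).
      by rewrite !finset.inE eqxx.
    - by move=> V z; rewrite finset.inE => /eqP->.
    - by move=> z zx; exists [set x]%SET; rewrite // finset.inE.
    - by move=> V W z; rewrite !finset.inE => /eqP-> /eqP->.
  by apply/noncrossingP => V W i k l m; rewrite !finset.inE => /eqP-> /eqP->.
move: pD; rewrite in_NCon => /andP[/partition_onP[p0 pS pC pU] _].
have xp V : V \in p -> x \notin V.
  by move=> Vp; apply/negP => /(pS _ _ Vp); rewrite !finset.inE eqxx.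
rewrite /nc_weight_at (@pblock_unique _ [set x]%SET); first last.
- move=> W; rewrite !finset.inE => /orP[Wp xW|/eqP//].
  by move: (xp W Wp); rewrite xW.
- by rewrite finset.inE.
- by rewrite !finset.inE eqxx orbT.
rewrite finset.cards1 addn1; congr (_ * _); apply: eq_bigl => V.
rewrite !finset.inE; have [->|//] := eqVneq V [set x]%SET; rewrite ?andbF ?orbF ?andbT //.
by apply/esym/negP => /xp; rewrite !finset.inE eqxx.
Qed.

Lemma nc_weight_at_glue j x y B q : x \notin B -> y \in B -> q \in NCon B ->
  nc_weight_at j x (finset.imset (glue x y) (mem q)) = nc_weight_at j.+1 y q.
Proof.
move=> xB yB; rewrite in_NCon => /andP[pD _]; have [p0 pS pC pU] := partition_onP _ _ pD.
have [Yq yY] := pblock_partition pD yB; set Y := finset.pblock q y in Yq yY *.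
have xq V : V \in q -> x \notin V by move=> Vq; apply: contra xB; apply: pS.
have gY : glue x y Y = x |: Y by rewrite /glue yY.
have ng W : W \in q -> W != Y -> glue x y W = W.
  move=> Wq WY; rewrite /glue; case: ifP => // yW.
  by rewrite (pU W Y y) ?eqxx // in WY.
have ngY W : W \in q -> W != Y -> W != x |: Y.
  move=> Wq WY; apply/eqP => WE; move: (xq W Wq).
  by rewrite WE !finset.inE eqxx.
have inj : {in q &, injective (glue x y)}.
  move=> V W Vq Wq; have [->|VY] := eqVneq V Y; have [->//|WY] := eqVneq W Y.
  - by rewrite gY ng // => E; move: (ngY W Wq WY); rewrite -E eqxx.
  - by rewrite gY ng // => E; move: (ngY V Vq VY); rewrite E eqxx.
  - by rewrite !ng.
rewrite /nc_weight_at (@pblock_unique _ (x |: Y)); first last.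
- move=> W /finset.imsetP[V Vq ->]; have [->|VY] := eqVneq V Y; first by rewrite gY.
  by rewrite ng // => xV; move: (xq V Vq); rewrite xV.
- by rewrite !finset.inE eqxx.
- by rewrite -gY; apply: finset.imset_f.
rewrite finset.cardsU1 xq // -/Y addnA addn1; congr (_ * _).
rewrite big_mkcondr /= finset.big_imset //= big_mkcondr /=; apply: eq_bigr => W Wq.
have [->|WY] := eqVneq W Y; first by rewrite gY eqxx.
by rewrite ng // ngY.
Qed.

Lemma nc_weight_atU j x A B p q : [disjoint A & B] -> x \in B ->
  p \in NCon A -> q \in NCon B ->
  (finset.pblock (p :|: q) x = finset.pblock q x) /\
  nc_weight_at j x (p :|: q) = (\prod_(V in p) kap #|V|) * nc_weight_at j x q.
Proof.
move=> dAB xB; rewrite !in_NCon => /andP[pA _] /andP[qB _].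
have [p0 pS pC pU] := partition_onP _ _ pA; have [q0 qS qC qU] := partition_onP _ _ qB.
have [Xq xX] := pblock_partition qB xB; set X := finset.pblock q x in Xq xX *.
have dis z : z \in A -> z \in B -> False.
  by move=> zA zB; move/fintype.disjointFr/(_ zA): dAB; rewrite zB.
have xp V : V \in p -> x \notin V.
  by move=> Vp; apply/negP => xV; apply: (dis x) => //; apply: pS xV.
have px : finset.pblock (p :|: q) x = X.
  apply: pblock_unique => //; first by rewrite finset.inE Xq orbT.
  move=> W; rewrite finset.inE => /orP[Wp xW|Wq xW]; first by move: (xp W Wp); rewrite xW.
  exact: (qU W X x).
split=> //; rewrite /nc_weight_at px -/X mulrCA; congr (_ * _).
rewrite big_mkcondr /= (eq_bigl [predU p & q]); last by move=> V; rewrite finset.inE.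
rewrite bigU /=; last first.
  apply/fintype.pred0P => V /=; apply/negP => /andP[Vp Vq].
  have [V0|[z zV]] := finset.set_0Vmem V; first by rewrite -V0 Vp in p0.
  by apply: (dis z); [apply: pS zV|apply: qS zV].
rewrite -!big_mkcondr /=; congr (_ * _); apply: eq_bigl => V.
case: (boolP (V \in p)) => //= Vp; apply/eqP => VX; move: (xp V Vp).
by rewrite VX xX.
Qed.

(** Here [y] is the second element of the block of [x]. A block meeting both the gap between [x] and
    [y] and its complement would cross that block, so the partition splits along the gap. In the
    remaining part [x] is removed and remembered as one more additional element of the block of [y],
    whence [j.+1]. *)
Lemma nc_sum_at_next j x y D : x \in D -> (forall z, z \in D -> (x <= z)%N) ->
  y \in D :\ x ->
  \sum_(p in NCon D | (y \in finset.pblock p x) &&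
      [forall z in finset.pblock p x, (z != x) ==> (y <= z)%N]) nc_weight_at j x p =
  nc_sum [set z in D | (x < z < y)%N]%SET * nc_sum_at j.+1 y [set z in D | (y <= z)%N]%SET.
Proof.
move=> xD minx; rewrite !finset.inE => /andP[yx yD].
set A := [set z in D | (x < z < y)%N]%SET; set B := [set z in D | (y <= z)%N]%SET.
have ltxz z : z \in D -> z != x -> (x < z)%N.
  by move=> zD zx; rewrite ltn_neqAle minx // andbT; apply: contra zx => /eqP/val_inj->.
have xy := ltxz y yD yx.
have xB : x \notin B by rewrite finset.inE xD leqNgt xy.
have yB : y \in B by rewrite finset.inE yD /=.
have defD : D = A :|: (x |: B).
  apply/finset.setP => z; rewrite !finset.inE; have [->|zx] := eqVneq z x.
    by rewrite xD /= orbT.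
  case: (boolP (z \in D)) => //= zD; rewrite ltxz //= ltnNge.
  by case: (y <= z)%N.
have dAB : [disjoint A & x |: B].
  apply/fintype.pred0P => z /=; rewrite !finset.inE; have [->|zx] := eqVneq z x.
    by rewrite ltnn andbF.
  by case: (z \in D) => //=; rewrite (ltnNge z); case: (y <= z)%N; rewrite ?andbF.
transitivity (\sum_(p in NCon (A :|: (x |: B)) |
    [forall V in p, (V \subset A) || (V \subset x |: B)])
    (if y \in finset.pblock p x then nc_weight_at j x p else 0)).
  rewrite -defD [RHS]big_mkcondr [LHS]big_mkcondr; apply: eq_bigr => p.
  rewrite in_NCon => /andP[pD /noncrossingP nc].
  have [_ pS _ pU] := partition_onP _ _ pD; have [bp xb] := pblock_partition pD xD.
  case: (boolP (y \in finset.pblock p x)) => /= yb; last by rewrite if_same.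
  congr (if _ then _ else _); set b := finset.pblock p x in bp xb yb *.
  apply/forallP/forallP => [nx V|spl z]; apply/implyP.
    move=> Vp; case: (boolP (V \subset A)) => //= /fintype.subsetPn[k kV kA].
    apply/fintype.subsetP => l lV; apply: contraT => lB.
    have lA : l \in A.
      have : l \in D by apply: pS lV.
      by rewrite defD finset.inE (negbTE lB) orbF.
    have kB : k \in x |: B.
      have : k \in D by apply: pS kV.
      by rewrite defD finset.inE (negbTE kA).
    move: (lA); rewrite finset.inE => /andP[lD /andP[xl ly]].
    have nVb : V <> b.
      move=> Vb; have := nx l; rewrite -Vb lV /= leqNgt ly implybF negbK => /eqP lx.
      by rewrite lx ltnn in xl.
    case: nVb; move: kB; rewrite !finset.inE => /orP[/eqP kx|/andP[kD yk]].
      by apply: (pU V b x) => //; rewrite -kx.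
    have [yk'|yk'] := eqVneq k y; first by apply: (pU V b y) => //; rewrite -yk'.
    symmetry; apply: (nc b V x l y k) => //.
    by rewrite ltn_neqAle yk andbT; apply: contra yk' => /eqP/val_inj->.
  move=> zb; apply/implyP => zx; have := spl b; rewrite bp /= => /orP[/fintype.subsetP/(_ x xb)|].
    by rewrite !finset.inE ltnn andbF.
  by move=> /fintype.subsetP/(_ z zb); rewrite !finset.inE (negbTE zx) => /andP[].
rewrite NCon_split //; last first.
  move=> i k l; rewrite !finset.inE => /andP[iD /andP[xi iy]] /orP[/eqP->|/andP[kD yk]].
    by move=> _; rewrite ltnNge ltnW.
  by move=> /andP[lD /andP[xl ly]] _ kl; move: (leq_ltn_trans yk kl); rewrite ltnNge ltnW.
rewrite /nc_sum big_distrl /=; apply: eq_bigr => p pA.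
transitivity ((\prod_(V in p) kap #|V|) *
   \sum_(q in NCon (x |: B) | y \in finset.pblock q x) nc_weight_at j x q).
  rewrite big_mkcondr big_distrr /=; apply: eq_bigr => q qB.
  have xxB : x \in x |: B by rewrite !finset.inE eqxx.
  have [-> ->] := nc_weight_atU j dAB xxB pA qB.
  by case: ifP => //; rewrite mulr0.
congr (_ * _); rewrite NCon_glue //; first last.
- by move=> z; rewrite finset.inE => /andP[].
- by move=> z; rewrite finset.inE => /andP[_]; apply: leq_trans.
by apply: eq_bigr => q qB; apply: nc_weight_at_glue qB.
Qed.

Lemma nc_sum_at_rec j x D : x \in D -> (forall z, z \in D -> (x <= z)%N) ->
  nc_sum_at j x D = kap j.+1 * nc_sum (D :\ x) +
  \sum_(y in D :\ x)
     nc_sum [set z in D | (x < z < y)%N]%SET * nc_sum_at j.+1 y [set z in D | (y <= z)%N]%SET.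
Proof.
move=> xD minx; rewrite /nc_sum_at (bigID (fun p => finset.pblock p x == [set x]%SET)) /=.
rewrite nc_sum_at_singleton //; congr (_ + _).
pose nx p y := (y \in finset.pblock p x) &&
      [forall z in finset.pblock p x, (z != x) ==> (y <= z)%N].
transitivity (\sum_(p in NCon D | finset.pblock p x != [set x]%SET)
    \sum_(y in D :\ x | nx p y) nc_weight_at j x p).
  apply: eq_bigr => p /andP[]; rewrite in_NCon => /andP[pD _] npx.
  have [_ pS _ pU] := partition_onP _ _ pD; have [bp xb] := pblock_partition pD xD.
  have [y0 y0b] : exists y0, (y0 \in finset.pblock p x) && (y0 != x).
    apply/existsP; apply: contraNT npx; rewrite negb_exists => /forallP H; apply/eqP/finset.setP => z.
    rewrite finset.inE; have := H z; case: (eqVneq z x) => [->|] //.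
    by rewrite andbT => _ /negbTE.
  case: (@arg_minnP _ y0 (fun z => (z \in finset.pblock p x) && (z != x)) val y0b) => y /andP[yb yx] miny.
  rewrite (big_pred1 y) // => z /=; apply/idP/eqP => [/andP[]|->].
    rewrite finset.in_setD1 => /andP[zx zD] /andP[zb /forallP/(_ y)].
    rewrite yb yx /= => zy; apply/val_inj/anti_leq; rewrite zy /=.
    by apply: miny; rewrite zb.
  rewrite finset.in_setD1 yx (pS _ _ bp) //=; apply/andP; split=> //.
  apply/forallP => t; apply/implyP => tb; apply/implyP => tx.
  by apply: miny; rewrite tb.
rewrite (exchange_big_dep (fun y => y \in D :\ x)) /=; last by move=> p y _ /andP[].
apply: eq_bigr => y yD; rewrite -nc_sum_at_next //; apply: eq_bigl => p.
rewrite yD /nx /=; case: (p \in NCon D) => //=.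
case: (boolP (y \in finset.pblock p x)) => [yb|]; last by rewrite andbF.
case: eqP => //= px; move: yb yD; rewrite px !finset.inE => /eqP->.
by rewrite eqxx.
Qed.

(** Removing the largest point, whose rank is [#|D|.-1], leaves the ranks of all other points
    unchanged. *)
Lemma sum_over_rank (T : nmodType) D (f : nat -> T) :
  \sum_(y in D) f #|[set z in D | (z < y)%N]%SET| = \sum_(i < #|D|) f i.
Proof.
have [m] := ubnP #|D|; elim: m D => // m IH D ltDm.
have [->|[x0 x0D]] := finset.set_0Vmem D.
  by rewrite finset.big_set0 finset.cards0 big_ord0.
case: (@arg_maxnP _ x0 (fun z => z \in D) val x0D) => x xD maxx.
rewrite (bigD1 x) //= (finset.cardsD1 x D) xD /= big_ord_recr /= addrC; congr (_ + f _).
  rewrite -IH; last by move: ltDm; rewrite (finset.cardsD1 x D) xD.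
  apply: eq_big => [y|y /andP[yD yx]]; first by rewrite !finset.inE andbC.
  congr f; congr #|pred_of_set _|; apply/finset.setP => z; rewrite !finset.inE.
  have [->|//] := eqVneq z x; rewrite /= xD /=; apply/negbTE; rewrite -leqNgt.
  exact: maxx.
congr #|pred_of_set _|; apply/finset.setP => z; rewrite !finset.inE.
case: (boolP (z \in D)) => zD /=; last by rewrite andbF.
rewrite andbT ltn_neqAle (maxx z zD : (z <= x)%N) andbT.
by congr negb; apply/eqP/eqP => [/val_inj|->].
Qed.

(** The gap before the second block element calls for the first claim and the rest for the second,
    so both go through one induction on [#|D|]. Allowing any subset of ['I_n] avoids relabelling the
    pieces. The value [kap 0 = 1] is the weight of the empty partition. *)
Lemma nc_sum_mc D : kap 0 = 1 -> nc_sum D = mc kap 0 #|D| /\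
  forall j x, x \in D -> (forall z, z \in D -> (x <= z)%N) ->
    nc_sum_at j x D = mc kap j #|D|.
Proof.
move=> kap0; have [m] := ubnP #|D|; elim: m D => // m IH D ltDm.
suff H j x : x \in D -> (forall z, z \in D -> (x <= z)%N) ->
    nc_sum_at j x D = mc kap j #|D|.
  split=> //; have [->|[x0 x0D]] := finset.set_0Vmem D.
    by rewrite nc_sum_set0 finset.cards0 mc0.
  case: (@arg_minnP _ x0 (fun z => z \in D) val x0D) => x xD minx.
  by rewrite (nc_sum_at0 xD) H.
move=> xD minx; rewrite nc_sum_at_rec //.
have cD : #|D| = #|D :\ x|.+1 by rewrite (finset.cardsD1 x D) xD.
(* The case of a singleton block is the last summand of [mcS], because [mc kap j.+1 0] is
   [kap j.+1]. The other summands are indexed by the rank of [y] in [D :\ x], which is the size of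
   the gap. *)
set k := #|D :\ x| in cD *; rewrite cD mcS big_ord_recr /= subnn mc0 [LHS]addrC; congr (_ + _).
  rewrite -[RHS](sum_over_rank (D :\ x) (fun i => mc kap 0 i * mc kap j.+1 (k - i))) /=.
  apply: eq_bigr => y /[dup] yD'; rewrite finset.in_setD1 => /andP[yx yD].
  have -> : [set z in D | (x < z < y)%N]%SET = [set z in D :\ x | (z < y)%N]%SET.
    apply/finset.setP => z; rewrite !finset.inE.
    have [->|zx] := eqVneq z x; first by rewrite ltnn andbF.
    case: (boolP (z \in D)) => //= zD; rewrite ltn_neqAle (minx z zD) andbT.
    by case: eqP => //= /val_inj xz; rewrite xz eqxx in zx.
  set L := [set z in D :\ x | (z < y)%N]%SET.
  have cU : (#|L| + #|[set z in D | (y <= z)%N]%SET| = k)%N.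
    rewrite /k -(finset.cardsID L (D :\ x)).
    congr addn; apply: eq_card => z.
      by rewrite !finset.inE [RHS]andbA andbb.
    rewrite !finset.inE; case: (boolP (z \in D)) => zD; rewrite ?andbF //= !andbT.
    have [->|zx] := eqVneq z x; last by rewrite /= andbT -leqNgt.
    rewrite /= leqNgt ltn_neqAle minx // andbT eq_sym.
    by case: eqP => // /val_inj yx'; rewrite yx' eqxx in yx.
  have y1 : (0 < #|[set z in D | (y <= z)%N]%SET|)%N.
    by apply/fintype.card_gt0P; exists y; rewrite finset.inE yD leqnn.
  have [|IH1 _] := IH L; first by rewrite cD in ltDm; lia.
  have [|_ IH2] := IH [set z in D | (y <= z)%N]%SET; first by rewrite cD in ltDm; lia.
  rewrite IH1 IH2; first last.
  - by move=> z; rewrite finset.inE => /andP[].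
  - by rewrite finset.inE yD leqnn.
  by rewrite -cU addKn.
by rewrite mulrC; congr (_ * _); case: (IH (D :\ x)) => //; rewrite cD in ltDm; lia.
Qed.

End NoncrossingRecursion.

Lemma NC_sum_mc (S : comNzRingType) (kap : nat -> S) (n : nat) : kap 0%N = 1 ->
  \sum_(p in NC n) \prod_(V in p) kap #|V| = mc kap 0 n.
Proof.
move=> kap0; have -> : NC n = NCon [set: 'I_n]%SET.
  by apply/finset.setP => p; rewrite !finset.inE.
by have [+ _] := nc_sum_mc [set: 'I_n]%SET kap0; rewrite finset.cardsT card_ord.
Qed.

(** * Generating series of the limit moments *)

Section GenusExpansionSeries.
Variable R : numFieldType.

(* The value of [goe_poly n] at [1 / N] is the [n]-th moment of the GOE of size [N]
   up to [O(1 / N ^ 2)]: the recursion is the loop equation with the covariances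
   of traces dropped. *)
Fixpoint goe_poly_fuel (N n : nat) : {poly R} :=
  if N is N'.+1 then
    if n is n'.+1 then
      \sum_(k < n') goe_poly_fuel N' k * goe_poly_fuel N' (n'.-1 - k) +
      n'%:R *: ('X * goe_poly_fuel N' n'.-1)
    else 1
  else 1.

Definition goe_poly (n : nat) : {poly R} := goe_poly_fuel n n.

Lemma goe_poly_fuelE N M n : (n <= N)%N -> (n <= M)%N -> goe_poly_fuel N n = goe_poly_fuel M n.
Proof.
elim: N M n => [|N IH] [|M] [|n] //= nN nM.
congr (_ + _ *: ('X * _)); last by apply: IH; lia.
by apply: eq_bigr => i _; congr (_ * _); apply: IH; have := ltn_ord i; lia.
Qed.

Lemma goe_poly0 : goe_poly 0 = 1.
Proof. by []. Qed.

Lemma goe_polyS n : goe_poly n.+1 = \sum_(k < n) goe_poly k * goe_poly (n.-1 - k) + n%:R *: ('X * goe_poly n.-1).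
Proof.
rewrite /goe_poly /=; congr (_ + _ *: ('X * _)); last by apply: goe_poly_fuelE; lia.
by apply: eq_bigr => i _; congr (_ * _); apply: goe_poly_fuelE; have := ltn_ord i; lia.
Qed.

Definition semicircle_moment (n : nat) : R := (goe_poly n)`_0.
Definition semicircle_inf_moment (n : nat) : R := (goe_poly n)`_1.
Local Notation c := semicircle_moment.
Local Notation v := semicircle_inf_moment.

Lemma semicircle_moment0 : c 0 = 1.
Proof. by rewrite /c goe_poly0 coef1. Qed.

Lemma semicircle_momentS n : c n.+1 = \sum_(k < n) c k * c (n.-1 - k).
Proof.
rewrite /c goe_polyS coefD coefZ coefXM mulr0 addr0 coef_sum; apply: eq_bigr => i _.
by rewrite coef0M.
Qed.

Lemma coef1M (p q : {poly R}) : (p * q)`_1 = p`_0 * q`_1 + p`_1 * q`_0.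
Proof. by rewrite coefM big_ord_recl big_ord_recl big_ord0 addr0. Qed.

Lemma semicircle_inf_moment0 : v 0 = 0.
Proof. by rewrite /v goe_poly0 coef1. Qed.

Lemma semicircle_inf_momentS n : v n.+1 =
  \sum_(k < n) (c k * v (n.-1 - k) + v k * c (n.-1 - k)) + n%:R * c n.-1.
Proof.
rewrite /v goe_polyS coefD coefZ coefXM /=; congr (_ + _); rewrite coef_sum.
by apply: eq_bigr => i _; rewrite coef1M.
Qed.

(** Divisibility by ['X^n] plays the part of equality of power series modulo t^n, so that series can
    be manipulated by ring identities in [{poly R}]. *)
Lemma dvdXnP (p : {poly R}) n : reflect (forall i, (i < n)%N -> p`_i = 0) ('X^n %| p).
Proof.
apply: (iffP idP) => [/dvdpP[q ->] i iltn|p0]; first by rewrite coefMXn iltn.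
rewrite -(poly_take_drop n p) dvdp_addr ?dvdp_mull //.
suff -> : take_poly n p = 0 by rewrite dvdp0.
by apply/polyP => i; rewrite coef_take_poly coef0; case: ifP => // /p0.
Qed.

Lemma dvdXn_deriv (p : {poly R}) n : 'X^n %| p -> 'X^(n.-1) %| p^`().
Proof.
move=> /dvdXnP p0; apply/dvdXnP => i iltn.
by rewrite coef_deriv p0 ?mul0rn //; lia.
Qed.

Section Truncation.
Variable N : nat.
Let P := \poly_(i < N) c i.
Let Q := ('X * P)^`().

Lemma truncated_semicircle_eq : 'X^N %| P - 1 - 'X^2 * P ^+ 2.
Proof.
apply/dvdXnP => -[|[|i]] iN; rewrite !coefB coef1 coefXnM coef_poly iN /=.
- by rewrite semicircle_moment0 !subr0 subrr.
- by rewrite semicircle_momentS big_ord0 !subr0.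
rewrite semicircle_momentS subr0 subSS subn1 /= expr2 coefM.
apply/eqP; rewrite subr_eq0; apply/eqP; apply: eq_bigr => k _ /=.
by rewrite !coef_poly !ifT //; have := ltn_ord k; lia.
Qed.

(* Differentiating [C = 1 + t^2 C^2] gives [(tC)' (1 - 2 t^2 C) = C], and the
   quadratic equation turns this into [(tC)' (2 - C) = C^2]. *)
Lemma truncated_semicircle_deriv : 'X^(N.-1) %| P ^+ 2 - Q * (2%:P - P).
Proof.
set F := P - 1 - 'X^2 * P ^+ 2.
have dF : 'X^N %| F := truncated_semicircle_eq.
have dF' := dvdXn_deriv dF.
have dF1 : 'X^(N.-1) %| F by apply: dvdp_trans dF; rewrite dvdp_exp2l // leq_pred.
have QE : Q = P + 'X * P^`() by rewrite /Q derivM derivX mul1r.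
have F'E : F^`() = P^`() - 'X * P ^+ 2 *+ 2 - 'X^2 * P * P^`() *+ 2.
  by rewrite /F !derivB derivM derivXn deriv_exp -polyC1 derivC /=; ring.
(* This factor has constant coefficient 1, hence is invertible modulo powers of ['X] and can be
   cancelled; the product with it is a combination of [F] and its derivative. *)
have co : coprimep 'X^(N.-1) (1 - 'X^2 * P *+ 2).
  rewrite coprimep_expl // coprimep_sym -[X in coprimep _ X]subr0 -polyC0.
  by rewrite coprimep_XsubC /root !hornerE /= expr0n /= !(mul0r, mul0rn, addr0, oppr0) oner_neq0.
rewrite -(Gauss_dvdpr _ co).
have -> : (1 - 'X^2 * P *+ 2) * (P ^+ 2 - Q * (2%:P - P)) =
    P * F *+ 2 - 'X * F^`() * (2%:P - P).
  by rewrite QE F'E /F; ring.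
apply: dvdp_sub; first by rewrite mulr2n dvdp_add ?dvdp_mull.
by rewrite dvdp_mulr // dvdp_mull.
Qed.

End Truncation.

(* The series [1 / (2 - C) = 1 + t^2 (tC)'], where [C] is the generating series of
   the semicircle moments. *)
Definition even_block_series (n : nat) : R :=
  match n with 0 => 1 | 1 => 0 | m.+2 => m.+1%:R * c m end.
Local Notation e := even_block_series.

(** In terms of series this is C^2 E = Q with Q = (t C)' and E = 1 + t^2 Q: indeed C^2 E = C^2 + (C
    - 1) Q by the quadratic equation, and C^2 = (2 - C) Q. *)
Lemma semicircle_deriv_conv m :
  \sum_(i < m.+1) c i * (\sum_(k < (m - i).+1) c k * e (m - i - k)) = m.+1%:R * c m.
Proof.
(* Differentiation costs one order of precision, and ['X^(N.-1)] must still control the coefficient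
   of index [m]. *)
pose N := m.+2; pose P := \poly_(i < N) c i; pose E := \poly_(i < N) e i.
pose Q := ('X * P)^`().
have QE i : (i < N)%N -> Q`_i = i.+1%:R * c i.
  by move=> iN; rewrite coef_deriv coefXM /= coef_poly iN mulr_natl.
have dE : 'X^(N.-1) %| E - 1 - 'X^2 * Q.
  apply/dvdXnP => i iN; rewrite !coefB coef1 coefXnM coef_poly ifT; last by rewrite /N in iN *; lia.
  case: i iN => [|[|i]] iN /=; rewrite ?subr0 ?subrr //.
  by rewrite subSS subn1 /= QE ?subrr //; rewrite /N in iN *; lia.
have dT : 'X^(N.-1) %| P ^+ 2 * E - Q.
  have -> : P ^+ 2 * E - Q = P ^+ 2 * (E - 1 - 'X^2 * Q) +
     (P ^+ 2 - Q * (2%:P - P)) - Q * (P - 1 - 'X^2 * P ^+ 2) by ring.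
  apply: dvdp_sub; first apply: dvdp_add.
  - exact: dvdp_mull.
  - exact: truncated_semicircle_deriv.
  - apply: dvdp_mull; apply: dvdp_trans (truncated_semicircle_eq N).
    by rewrite dvdp_exp2l.
have /dvdXnP/(_ m) := dT; rewrite coefB => /(_ (leqnn _))/eqP; rewrite subr_eq0 => /eqP.
rewrite QE // => <-; rewrite expr2 -mulrA coefM; apply: eq_bigr => i _.
rewrite coef_poly ifT; last by have := ltn_ord i; rewrite /N; lia.
congr (_ * _); rewrite coefM; apply: eq_bigr => k _; rewrite !coef_poly !ifT //.
  by have := ltn_ord i; rewrite /N; lia.
by have := ltn_ord k; rewrite /N; lia.
Qed.

End GenusExpansionSeries.

(** * Solving the recursion to first order in eps *)

Section InfinitesimalCumulants.
Variable R : numFieldType.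
Local Notation c := (semicircle_moment R).
Local Notation v := (semicircle_inf_moment R).
Local Notation e := (even_block_series R).

Lemma coef0_prod (I : eqType) (r : seq I) (f : I -> {poly R}) :
  (\prod_(i <- r) f i)`_0 = \prod_(i <- r) (f i)`_0.
Proof.
elim: r => [|i r IH]; first by rewrite !big_nil coef1.
by rewrite !big_cons coef0M IH.
Qed.

Lemma coef1_prod (I : eqType) (r : seq I) (f : I -> {poly R}) : uniq r ->
  (\prod_(i <- r) f i)`_1 =
  \sum_(i <- r) (f i)`_1 * \prod_(j <- r | j != i) (f j)`_0.
Proof.
elim: r => [|i r IH]; first by rewrite !big_nil coef1.
move=> /= /andP[ir ur]; rewrite !big_cons coef1M IH // addrC eqxx /=; congr (_ + _).
  rewrite coef0_prod; congr (_ * _); rewrite big_seq [RHS]big_seq_cond.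
  apply: eq_bigl => j; case: (boolP (j \in r)) => //= jr.
  by apply/esym; apply: contraNneq ir => <-.
rewrite big_distrr /= !big_seq; apply: eq_bigr => j jr.
rewrite big_cons ifT; first by rewrite mulrCA.
by apply: contraNneq ir => ->.
Qed.

(* Matching the moments determines the cumulants one at a time: the top cumulant
   enters the recursion with coefficient [g 0 = 1]. *)
Lemma mc_diff_eq0 (g : nat -> R) (d : nat -> nat -> R) : g 0%N = 1 ->
  (forall j n, d j n.+1 = \sum_(i < n.+1) g i * d j.+1 (n - i)%N) ->
  (forall n, d 0%N n = 0) -> forall j n, d j n = 0.
Proof.
move=> g0 dS d0; suff H m j n : (j + n)%N = m -> d j n = 0 by move=> j n; apply: (H (j + n)%N).
have [M] := ubnP m; elim: M m j n => // M IH m j n ltmM.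
(* Entries of smaller index sum vanish by induction, so in the recursion only the summand [i = 0]
   survives. All entries on the antidiagonal [m] are therefore equal, and one of them is
   [d 0 m = 0]. *)
have top k l : (k + l)%N = m -> d k l = d m 0%N.
  elim: l k => [|l IHl] k; first by rewrite addn0 => ->.
  move=> klm; rewrite dS big_ord_recl /= g0 mul1r subn0 IHl; last by lia.
  rewrite big1 ?addr0 // => i _; rewrite (IH (k.+1 + (l - bump 0 i))%N) ?mulr0 //.
  by rewrite /bump /= in IHl *; have := ltn_ord i; lia.
by move=> jn; rewrite (top j n jn) -(top 0%N m) ?d0.
Qed.

(** The coefficients of the series C, t C, 1, 0, ..., that is, of Z_j for the cumulants delta_2. *)
Definition semicircle_mc (j n : nat) : R :=
  match j with
  | 0 => c n | 1 => if n is m.+1 then c m else 0 | 2 => (n == 0%N)%:R | _ => 0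
  end.

Lemma semicircle_mcS j n : semicircle_mc j n.+1 = \sum_(i < n.+1) c i * semicircle_mc j.+1 (n - i)%N.
Proof.
case: j => [|[|[|j]]] /=.
- rewrite semicircle_momentS big_ord_recr /= subnn mulr0 addr0; apply: eq_bigr => i _.
  by have -> : (n - i = (n.-1 - i).+1)%N by have := ltn_ord i; lia.
- rewrite big_ord_recr /= subnn eqxx mulr1 big1 ?add0r // => i _.
  by rewrite subn_eq0 leqNgt ltn_ord mulr0.
- by rewrite big1 // => i _; rewrite mulr0.
- by rewrite big1 // => i _; rewrite mulr0.
Qed.

Definition odd_block_series (n : nat) : R :=
  if n is m.+1 then \sum_(i < m.+1) c i * e (m - i)%N else 0.
Local Notation o := odd_block_series.

(** The infinitesimal parts of the Z_j: V, then O + t V, then E and O in alternation. Their entries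
    at [n = 0] are the claimed infinitesimal cumulants. *)
Definition semicircle_inf_mc (j n : nat) : R :=
  match j with
  | 0 => v n
  | 1 => o n + (if n is m.+1 then v m else 0)
  | _ => if odd j then o n else e n
  end.

Lemma even_block_seriesS n : e n.+1 = \sum_(i < n.+1) c i * o (n - i)%N.
Proof.
case: n => [|m]; first by rewrite big_ord1 /= mulr0.
rewrite /= -semicircle_deriv_conv [RHS]big_ord_recr /= subnn mulr0 addr0.
by apply: eq_bigr => i _; rewrite subSn //; have := ltn_ord i; lia.
Qed.

Lemma semicircle_inf_mcS j n : semicircle_inf_mc j n.+1 =
  \sum_(i < n.+1) (c i * semicircle_inf_mc j.+1 (n - i)%N + v i * semicircle_mc j.+1 (n - i)%N).
Proof.
rewrite big_split /=; case: j => [|[|j]].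
- rewrite [LHS]semicircle_inf_momentS /=.
  rewrite (eq_bigr (fun i : 'I_n.+1 => c i * o (n - i)%N +
     c i * (if (n - i)%N is m.+1 then v m else 0))); last by move=> i _; rewrite mulrDr.
  (* The part C O equals [e n.+1], which is exactly the inhomogeneous term [n * c n.-1] of the
     recursion for [v]; the parts C (t V) and V (t C) give the two halves of its convolution. *)
  rewrite !big_split /= -even_block_seriesS [LHS]addrC -[RHS]addrA; congr (_ + _).
    by case: n => [|n] /=; rewrite ?mulr0n ?mul0r.
  rewrite !(@big_ord_recr _ _ _ n) /= subnn !mulr0 !addr0.
  by congr (_ + _); apply: eq_bigr => i _;
     have -> : (n - i = (n.-1 - i).+1)%N by have := ltn_ord i; lia.
- congr (_ + _) => /=; rewrite big_ord_recr /= subnn eqxx mulr1 big1 ?add0r // => i _.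
  by rewrite subn_eq0 leqNgt ltn_ord mulr0.
- rewrite /= [X in _ + X]big1 ?addr0; last by move=> i _; rewrite mulr0.
  rewrite negbK; case: (odd j) => /=; last exact: even_block_seriesS.
  by [].
Qed.

Theorem semicircle_inf_cumulants (kappa kappa' : nat -> R) :
  (forall n, (0 < n)%N -> c n = \sum_(p in NC n) \prod_(V in p) kappa #|V|) ->
  (forall n, (0 < n)%N -> v n = \sum_(p in NC n) \sum_(V in p)
      kappa' #|V| * \prod_(W in p | W != V) kappa #|W|) ->
  forall n, (2 <= n)%N -> ~~ odd n -> kappa' n = 1.
Proof.
move=> cE vE.
(* The variable ['X] plays the part of eps. The value at 0 is set to 1 because [kappa 0] is
   unconstrained while the recursion starts from the empty partition. *)
pose kap n : {poly R} := if n == 0%N then 1 else (kappa n)%:P + kappa' n *: 'X.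
have kap0 n : (0 < n)%N -> (kap n)`_0 = kappa n.
  by case: n => // n _; rewrite coefD coefC coefZ coefX mulr0 addr0.
have kap1 n : (0 < n)%N -> (kap n)`_1 = kappa' n.
  by case: n => // n _; rewrite coefD coefC coefZ coefX mulr1 add0r.
pose a j n := (mc kap j n)`_0; pose b j n := (mc kap j n)`_1.
have blk_gt0 n p V : p \in NC n -> V \in p -> (0 < #|V|)%N.
  rewrite finset.inE => /andP[/and3P[_ _ p0] _] Vp; rewrite finset.card_gt0.
  by apply: contraNneq p0 => <-.
have a0 n : a 0%N n = c n.
  case: n => [|n]; first by rewrite /a mc0 /kap /= coef1 semicircle_moment0.
  rewrite cE // /a -NC_sum_mc // coef_sum; apply: eq_bigr => p pNC.
  rewrite -big_enum coef0_prod big_enum; apply: eq_bigr => V Vp.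
  by rewrite kap0 // (blk_gt0 _ p).
have b0 n : b 0%N n = v n.
  case: n => [|n]; first by rewrite /b mc0 /kap /= coef1 semicircle_inf_moment0.
  rewrite vE // /b -NC_sum_mc // coef_sum; apply: eq_bigr => p pNC.
  rewrite -big_enum coef1_prod ?enum_uniq // big_enum; apply: eq_bigr => V Vp.
  rewrite kap1 ?(blk_gt0 _ p) //; congr (_ * _); rewrite big_enum_cond.
  by apply: eq_bigr => W /andP[Wp _]; rewrite kap0 // (blk_gt0 _ p).
have aS j n : a j n.+1 = \sum_(i < n.+1) c i * a j.+1 (n - i)%N.
  by rewrite /a mcS coef_sum; apply: eq_bigr => i _; rewrite coef0M -a0.
have bS j n : b j n.+1 = \sum_(i < n.+1) (c i * b j.+1 (n - i)%N + v i * a j.+1 (n - i)%N).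
  by rewrite /b mcS coef_sum; apply: eq_bigr => i _; rewrite coef1M -a0 -b0.
have aE j n : a j n = semicircle_mc j n.
  apply/eqP; rewrite -subr_eq0; apply/eqP.
  apply: (@mc_diff_eq0 c (fun j n => a j n - semicircle_mc j n)) => [|k l|l] /=.
  - exact: semicircle_moment0.
  - rewrite aS semicircle_mcS -sumrB; apply: eq_bigr => i _; rewrite mulrBr.
    by [].
  - by rewrite a0 subrr.
(* Since [a] is already identified, the terms with [v] cancel in the difference, which then
   satisfies the homogeneous recursion of [mc_diff_eq0]. *)
have bE j n : b j n = semicircle_inf_mc j n.
  apply/eqP; rewrite -subr_eq0; apply/eqP.
  apply: (@mc_diff_eq0 c (fun j n => b j n - semicircle_inf_mc j n)) => [|k l|l] /=.
  - exact: semicircle_moment0.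
  - rewrite bS semicircle_inf_mcS -sumrB; apply: eq_bigr => i _; by rewrite aE opprD addrACA subrr addr0 -mulrBr.
  - by rewrite b0 subrr.
(* With no points left, the recursion returns the cumulant itself, and for even [j >= 2] the
   tabulated value is [e 0 = 1]. *)
case=> [|[|n]] // _ no; rewrite -kap1 // -[kap _](mc0 kap) -/(b n.+2 0%N) bE.
by rewrite /= in no *; rewrite negbK in no *; rewrite (negbTE no).
Qed.

End InfinitesimalCumulants.

(** * Asymptotics from the loop equation *)

Section LoopAsymptotics.
Variable R : realType.

(* The terms produced by contracting a factor of [tr X ^+ n.+1] with one of the
   traces [tr X ^+ m], [m] in [l]: multiplicities and resulting exponents. *)
Fixpoint trace_contractions (n : nat) (l : seq nat) : seq (nat * seq nat) :=
  if l is m :: l' then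
    (m, (n + m).-1 :: l') :: [seq (x.1, m :: x.2) | x <- trace_contractions n l']
  else [::].

(** Total degree plus number of traces is the induction measure of the factorisation; its value at
    [n.+1 :: l] exceeds the bound given here by two. *)
Lemma trace_contractions_size n l x : x \in trace_contractions n l ->
  (sumn x.2 + size x.2 <= n + sumn l + size l)%N.
Proof.
elim: l x => //= m l IH x; rewrite inE => /orP[/eqP->/=|/mapP[y /IH H ->] /=]; lia.
Qed.

Definition bounded_seq (f : nat -> R) :=
  exists C : R, forall N, (0 < N)%N -> `|f N| <= C.
Definition quadratically_small (f : nat -> R) :=
  exists C : R, forall N, (0 < N)%N -> `|f N| <= C * N%:R^-1 ^+ 2.

Lemma inv_nat_bounds (N : nat) : (0 < N)%N -> 0 < (N%:R^-1 : R) /\ (N%:R^-1 : R) <= 1.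
Proof.
by move=> N0; rewrite invr_gt0 ltr0n N0 invf_le1 ?ltr0n // ler1n.
Qed.

Lemma quadratically_small_ext f g : (forall N, (0 < N)%N -> f N = g N) ->
  quadratically_small f -> quadratically_small g.
Proof. by move=> fg [C HC]; exists C => N N0; rewrite -fg // HC. Qed.

Lemma quadratically_smallD f g : quadratically_small f -> quadratically_small g ->
  quadratically_small (fun N => f N + g N).
Proof.
move=> [C HC] [D HD]; exists (C + D) => N N0; rewrite mulrDl.
by apply: le_trans (ler_normD _ _) _; rewrite lerD ?HC ?HD.
Qed.

Lemma quadratically_small0 : quadratically_small (fun=> 0).
Proof. by exists 0 => N _; rewrite normr0 mul0r. Qed.

Lemma quadratically_small_sum (I : Type) (r : seq I) (F : I -> nat -> R) :
  (forall i, quadratically_small (F i)) ->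
  quadratically_small (fun N => \sum_(i <- r) F i N).
Proof.
move=> HF; elim: r => [|i r IH].
  by apply: quadratically_small_ext quadratically_small0 => N _; rewrite big_nil.
apply: quadratically_small_ext (quadratically_smallD (HF i) IH) => N _.
by rewrite big_cons.
Qed.

Lemma quadratically_smallM f g : bounded_seq f -> quadratically_small g ->
  quadratically_small (fun N => f N * g N).
Proof.
move=> [C HC] [D HD]; exists (C * D) => N N0; rewrite normrM -mulrA.
by rewrite ler_pM ?HC ?HD.
Qed.

Lemma quadratically_small_sqr f : bounded_seq f ->
  quadratically_small (fun N => N%:R^-1 ^+ 2 * f N).
Proof.
move=> [C HC]; exists C => N N0; rewrite normrM ger0_norm ?exprn_ge0 ?invr_ge0 //.
by rewrite mulrC ler_wpM2r ?HC // exprn_ge0 // invr_ge0.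
Qed.

Lemma quadratically_small_bounded f : quadratically_small f -> bounded_seq f.
Proof.
move=> [C HC]; exists `|C| => N N0; apply: le_trans (HC N N0) _.
have [u0 u1] := inv_nat_bounds N0; apply: le_trans (ler_norm _) _.
by rewrite normrM ler_piMr // ger0_norm ?exprn_ge0 ?(ltW u0) // exprn_ile1 // ltW.
Qed.

Lemma bounded_seqD f g : bounded_seq f -> bounded_seq g ->
  bounded_seq (fun N => f N + g N).
Proof.
move=> [C HC] [D HD]; exists (C + D) => N N0.
by apply: le_trans (ler_normD _ _) _; rewrite lerD ?HC ?HD.
Qed.

Lemma bounded_seqM f g : bounded_seq f -> bounded_seq g ->
  bounded_seq (fun N => f N * g N).
Proof.
move=> [C HC] [D HD]; exists (C * D) => N N0; rewrite normrM.
by rewrite ler_pM ?HC ?HD.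
Qed.

Lemma bounded_seq_cst (x : R) : bounded_seq (fun=> x).
Proof. by exists `|x|. Qed.

Lemma bounded_seq_inv : bounded_seq (fun N => N%:R^-1).
Proof.
by exists 1 => N N0; have [u0 u1] := inv_nat_bounds N0; rewrite gtr0_norm.
Qed.

Lemma bounded_seq_ext f g : (forall N, (0 < N)%N -> f N = g N) ->
  bounded_seq f -> bounded_seq g.
Proof. by move=> fg [C HC]; exists C => N N0; rewrite -fg // HC. Qed.

Lemma bounded_seq_horner (p : {poly R}) : bounded_seq (fun N => p.[N%:R^-1]).
Proof.
elim/poly_ind: p => [|p x IH].
  by apply: bounded_seq_ext (bounded_seq_cst 0) => N _; rewrite horner0.
apply: bounded_seq_ext (bounded_seqD (bounded_seqM IH bounded_seq_inv) (bounded_seq_cst x)).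
by move=> N _; rewrite hornerMXaddC.
Qed.

Variable M : nat -> seq nat -> R.
Hypothesis M_nil : forall N, (0 < N)%N -> M N [::] = 1.
Hypothesis M_0 : forall N l, (0 < N)%N -> M N (0%N :: l) = M N l.
Hypothesis M_loop : forall N n l, (0 < N)%N -> M N (n.+1 :: l) =
  \sum_(k < n) M N ((k : nat) :: (n.-1 - k)%N :: l) + n%:R / N%:R * M N (n.-1 :: l) +
  2 * N%:R^-1 ^+ 2 * \sum_(x <- trace_contractions n l) x.1%:R * M N x.2.

(* The joint moments factorise up to [O(1 / N ^ 2)]: the only term of the loop
   equation coupling two traces carries the factor [1 / N ^ 2]. *)
Lemma loop_moments_factorise l :
  quadratically_small (fun N => M N l - \prod_(m <- l) (goe_poly R m).[N%:R^-1]).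
Proof.
(* Splitting a trace lowers the total degree by two and adds one trace, so the sum of degree and
   length still decreases. *)
have [b] := ubnP (sumn l + size l)%N; elim: b l => // b IH [|[|n] l] ltb.
- apply: quadratically_small_ext quadratically_small0 => N N0.
  by rewrite M_nil // big_nil subrr.
- apply: quadratically_small_ext (IH l _); last by move: ltb => /=; lia.
  by move=> N N0; rewrite M_0 // big_cons goe_poly0 hornerC mul1r.
have bnd l' : (sumn l' + size l' < b)%N -> bounded_seq (M ^~ l').
  move=> /IH/quadratically_small_bounded H.
  have Pb : bounded_seq (fun N => \prod_(m <- l') (goe_poly R m).[N%:R^-1]).
    elim: (l') => [|m s IHs].
      by apply: bounded_seq_ext (bounded_seq_cst 1) => N _; rewrite big_nil.
    apply: bounded_seq_ext (bounded_seqM (bounded_seq_horner (goe_poly R m)) IHs).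
    by move=> N _; rewrite big_cons.
  by apply: bounded_seq_ext (bounded_seqD H Pb) => N _; rewrite subrK.
pose err l' N := M N l' - \prod_(m <- l') (goe_poly R m).[N%:R^-1].
have S1 : quadratically_small (fun N => \sum_(k < n) err ((k : nat) :: (n.-1 - k)%N :: l) N).
  apply: quadratically_small_sum => k; apply: IH; move: ltb => /=.
  by have := ltn_ord k; lia.
have S2 : quadratically_small (fun N => n%:R / N%:R * err (n.-1 :: l) N).
  apply: quadratically_smallM; first exact: bounded_seqM (bounded_seq_cst _) bounded_seq_inv.
  by apply: IH; move: ltb => /=; lia.
have S3 : quadratically_small (fun N => N%:R^-1 ^+ 2 *
    (2 * \sum_(x <- trace_contractions n l) x.1%:R * M N x.2)).
  apply/quadratically_small_sqr/(bounded_seqM (bounded_seq_cst _)).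
  have : {subset trace_contractions n l <= trace_contractions n l} by [].
  elim: {1 3}(trace_contractions n l) => [|x r IHr] sub.
    by apply: bounded_seq_ext (bounded_seq_cst 0) => N _; rewrite big_nil.
  have bx : bounded_seq (fun N => x.1%:R * M N x.2).
    apply: bounded_seqM (bounded_seq_cst _) (bnd _ _).
    have /trace_contractions_size : x \in trace_contractions n l by apply: sub; rewrite inE eqxx.
    by move: ltb => /=; lia.
  apply: bounded_seq_ext (bounded_seqD bx (IHr _)); last first.
    by move=> y yr; apply: sub; rewrite inE yr orbT.
  by move=> N _; rewrite big_cons.
apply: quadratically_small_ext (quadratically_smallD (quadratically_smallD S1 S2) S3).
move=> N N0; rewrite M_loop // big_cons goe_polyS hornerD hornerZ hornerM hornerX horner_sum.
rewrite /err sumrB big_cons.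
rewrite [X in _ - X + _](eq_bigr (fun k : 'I_n => (goe_poly R k * goe_poly R (n.-1 - k)).[N%:R^-1] *
    \prod_(m <- l) (goe_poly R m).[N%:R^-1])); last first.
  by move=> k _; rewrite !big_cons hornerM mulrA.
rewrite -big_distrl /=; ring.
Qed.

Lemma lim_inv_rate (f : nat -> R) (L C : R) :
  (forall N, (0 < N)%N -> `|f N - L| <= C * N%:R^-1) -> limn f = L.
Proof.
move=> H; apply: cvg_lim => //; apply/cvgrPdist_le => eps eps0.
have C0 : 0 <= C by have := H 1%N isT; rewrite invr1 mulr1; apply: le_trans.
near=> N; have N0 : (0 < N)%N by near: N; exact: nbhs_infty_gt.
rewrite distrC; apply: le_trans (H N N0) _; rewrite ler_pdivrMr ?ltr0n // mulrC.
rewrite -ler_pdivrMr //; near: N; exact: nbhs_infty_ger.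
Unshelve. all: by end_near. Qed.

(** Cutting [goe_poly R n] after degree one leaves 1 / N^2 times a polynomial in 1 / N, which is
    bounded. *)
Lemma loop_first_order n : exists C : R, forall N, (0 < N)%N ->
  `|M N [:: n] - semicircle_moment R n - semicircle_inf_moment R n * N%:R^-1|
  <= C * N%:R^-1 ^+ 2.
Proof.
pose q := drop_poly 2 (goe_poly R n).
have := quadratically_smallD (loop_moments_factorise [:: n])
  (quadratically_small_sqr (bounded_seq_horner q)).
apply: quadratically_small_ext => N N0; rewrite big_seq1.
rewrite -{1}(poly_take_drop 2 (goe_poly R n)) hornerD hornerM hornerXn -/q.
have -> : take_poly 2 (goe_poly R n) = (semicircle_moment R n)%:P + semicircle_inf_moment R n *: 'X.
  apply/polyP => -[|[|i]]; rewrite coef_take_poly coefD coefC coefZ coefX /= ?mulr0 ?addr0 //.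
  by rewrite mulr1 add0r.
rewrite hornerD hornerC hornerZ hornerX; ring.
Qed.

Lemma loop_moment n : limn (fun N => M N [:: n]) = semicircle_moment R n.
Proof.
have [C HC] := loop_first_order n.
apply: (@lim_inv_rate _ _ (`|C| + `|semicircle_inf_moment R n|)) => N N0.
have [u0 u1] := inv_nat_bounds N0; set v := semicircle_inf_moment R n in HC *.
rewrite -[X in `|X|](subrK (v * N%:R^-1)); apply: le_trans (ler_normD _ _) _.
rewrite mulrDl lerD // ?normrM ?(ger0_norm (ltW u0)) //.
apply: le_trans (HC N N0) _; apply: le_trans (ler_norm _) _.
by rewrite normrM ler_wpM2l // expr2 normrM (ger0_norm (ltW u0)) ler_piMr // ltW.
Qed.

Lemma loop_inf_moment n :
  limn (fun N => N%:R * (M N [:: n] - semicircle_moment R n)) = semicircle_inf_moment R n.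
Proof.
have [C HC] := loop_first_order n; apply: (@lim_inv_rate _ _ C) => N N0.
have [u0 u1] := inv_nat_bounds N0; have NN : (N%:R : R) != 0 by rewrite pnatr_eq0 -lt0n.
have -> : N%:R * (M N [:: n] - semicircle_moment R n) - semicircle_inf_moment R n =
  N%:R * (M N [:: n] - semicircle_moment R n - semicircle_inf_moment R n * N%:R^-1).
  by field.
rewrite normrM ger0_norm // mulrC -ler_pdivlMr ?ltr0n // -mulrA -expr2.
exact: HC.
Qed.

End LoopAsymptotics.

(** * Gaussian moments and independence *)

Section WeightedPushforward.
Local Open Scope classical_set_scope.
Local Open Scope ereal_scope.
Context d d' (T : measurableType d) (T' : measurableType d') (R : realType).
Variables (mu : {measure set T -> \bar R}) (nu : {measure set T' -> \bar R}).
Variables (X : T -> T') (H : T -> R).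
Hypothesis mX : measurable_fun setT X.
Hypothesis mH : measurable_fun setT H.
Hypothesis H0 : forall x, (0 <= H x)%R.
Hypothesis nuE : forall B, measurable B ->
  \int[mu]_x (\1_B (X x) * H x)%:E = nu B.

Import HBNNSimple.

(** Passage from indicators to simple functions, then monotone convergence. It serves twice: with
    [H] the product of the other independent factors, and with [X] the identity and [H] the normal
    density. *)
Lemma ge0_integral_weighted_pushforward (f : T' -> R) :
  measurable_fun setT f -> (forall y, 0 <= f y)%R ->
  \int[mu]_x (f (X x) * H x)%:E = \int[nu]_y (f y)%:E.
Proof.
move=> mf f0.
have mf' : measurable_fun setT (fun y => (f y)%:E) by exact/measurable_EFinP.
have mfX (g : T' -> R) : measurable_fun setT g ->
    measurable_fun setT (fun x => (g (X x) * H x)%:E).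
  move=> mg; apply/measurable_EFinP/measurable_funM => //.
  exact: measurableT_comp.
pose f_ := nnsfun_approx measurableT mf'.
have cvgf y : (f_ n y)%:E @[n --> \oo] --> (f y)%:E.
  by apply: cvg_nnsfun_approx => // z _; rewrite lee_fin.
transitivity (limn (fun n => \int[mu]_x (f_ n (X x) * H x)%:E)); last first.
  transitivity (limn (fun n => \int[nu]_y (f_ n y)%:E)); last first.
    rewrite -monotone_convergence//.
    - by apply: eq_integral => y _; exact/cvg_lim.
    - by move=> n; exact/measurable_EFinP/measurable_funP.
    - by move=> n y _; rewrite lee_fin.
    - by move=> y _ m n mn; rewrite lee_fin; exact/lefP/nd_nnsfun_approx.
  congr (limn _); apply/funext => n.
  have mpre r : measurable (f_ n @^-1` [set r]) by exact: measurable_sfunP.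
  rewrite integralT_nnsfun sintegralE.
  transitivity (\int[mu]_x (\sum_(k \in range (f_ n))
      (k * (\1_(f_ n @^-1` [set k]) (X x) * H x))%:E)).
    apply: eq_integral => x _; rewrite {1}(fimfunE (f_ n) (X x)).
    rewrite EFinM -fsumEFin//= ge0_mule_fsuml//; last first.
      by move=> r; rewrite EFinM; exact: nnfun_muleindic_ge0.
    by apply: eq_fsbigr => r _; rewrite -EFinM mulrA.
  rewrite ge0_integral_fsum//; last 2 first.
    - move=> r; apply/measurable_EFinP/measurable_funM => //.
      exact/measurable_EFinP/(mfX (\1_(f_ n @^-1` [set r])))/measurable_indic.
    - move=> r x _; rewrite mulrA lee_fin mulr_ge0//.
      by have := nnfun_muleindic_ge0 (f_ n) r (X x); rewrite -EFinM lee_fin.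
  apply: eq_fsbigr => r rf.
  have r0 : (0 <= r)%R by move: rf; rewrite inE => -[y _ <-].
  under eq_integral do rewrite EFinM.
  rewrite ge0_integralZl_EFin//.
  - by rewrite nuE.
  - by move=> x _; rewrite lee_fin mulr_ge0.
  - exact/(mfX (\1_(f_ n @^-1` [set r])))/measurable_indic.
rewrite -monotone_convergence//.
- apply: eq_integral => x _; apply/esym/cvg_lim => //.
  rewrite EFinM; under eq_fun do rewrite EFinM.
  by apply: cvgeZr => //; exact: cvgf.
- by move=> n; exact: mfX.
- by move=> n x _; rewrite lee_fin mulr_ge0.
- by move=> x _ m n mn; rewrite lee_fin ler_wpM2r//; exact/lefP/nd_nnsfun_approx.
Qed.

End WeightedPushforward.

(** * Moments of the normal density *)

Section GaussianMoments.
Local Open Scope classical_set_scope.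
Variable R : realType.
Local Notation leb := (@lebesgue_measure R).
Local Notation phi := (@normal_pdf R 0 1).

Lemma normal_pdf01E x : phi x = normal_peak 1 * expR (- x ^+ 2 / 2).
Proof. by rewrite normal_pdfE ?oner_neq0 // /normal_fun subr0 expr1n. Qed.

(** Doubling the standard deviation absorbs polynomial growth: exp(- x^2 / 2) = exp(- t) exp(- x^2 /
    8) with t = 3 x^2 / 8. The constant [K] comes from |x|^k <= 1 + (8 t / 3)^(k + 1) and exp t >= 1
    + t^(k + 1) / (k + 1)!. The bound yields integrability as well as decay at infinity. *)
Lemma powr_normal_pdf_le k : exists2 C : R, 0 <= C & forall x,
  `|x ^+ k * phi x| <= C * normal_pdf 0 2 x.
Proof.
pose K : R := 1 + (8 / 3) ^+ k.+1 * k.+1`!%:R.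
have K0 : 0 <= K by rewrite addr_ge0 // mulr_ge0 // exprn_ge0 // divr_ge0.
have p1 : 0 < normal_peak (1 : R) by rewrite normal_peak_gt0 ?oner_neq0.
have p2 : 0 < normal_peak (2 : R) by rewrite normal_peak_gt0.
exists (K * normal_peak 1 / normal_peak 2); first by rewrite divr_ge0 ?mulr_ge0 ?(ltW p1) ?(ltW p2).
move=> x; rewrite normal_pdf01E normal_pdfE //.
have e0 : 0 <= normal_peak 1 * expR (- x ^+ 2 / 2) by rewrite mulr_ge0 ?expR_ge0 ?(ltW p1).
rewrite normrM (ger0_norm e0) mulrCA [leRHS]mulrA divfK ?gt_eqF // mulrC.
rewrite [leRHS]mulrAC ler_wpM2r ?(ltW p1) //.
pose t : R := 3 / 8 * x ^+ 2.
have t0 : 0 <= t by rewrite mulr_ge0 ?sqr_ge0 // divr_ge0.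
have -> : expR (- x ^+ 2 / 2) = expR (- t) * normal_fun 0 2 x.
  by rewrite /normal_fun -expRD subr0; congr expR; rewrite /t; field.
rewrite mulrA ler_wpM2r ?normal_fun_ge0 // expRN ler_pdivrMr ?expR_gt0 //.
rewrite normrX; apply: (@le_trans _ _ (K * (1 + t ^+ k.+1 / k.+1`!%:R))); last first.
  by rewrite ler_wpM2l // expR_ge1Dxn.
have f0 : (0 : R) < k.+1`!%:R by rewrite ltr0n fact_gt0.
have H1 : `|x| ^+ k <= 1 + (x ^+ 2) ^+ k.+1.
  have [x1|x1] := leP `|x| 1.
    apply: (@le_trans _ _ 1); first by rewrite exprn_ile1.
    by rewrite lerDl exprn_ge0 // sqr_ge0.
  apply: (@le_trans _ _ ((x ^+ 2) ^+ k.+1)); last by rewrite lerDr.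
  rewrite -real_normK ?num_real // -exprM ler_weXn2l // ?ltW //; lia.
apply: le_trans H1 _; rewrite mulrDr mulr1 lerD //.
  by rewrite lerDl mulr_ge0 // exprn_ge0 // divr_ge0.
have -> : x ^+ 2 = 8 / 3 * t by rewrite /t; field.
rewrite exprMn mulrA [leRHS]mulrAC ler_wpM2r ?exprn_ge0 //.
rewrite ler_pdivlMr // /K; rewrite lerDr //.
Qed.

Lemma measurable_powr_normal_pdf k :
  measurable_fun [set: R] (fun x => x ^+ k * phi x).
Proof.
by apply: measurable_funM; [exact: measurable_funX|exact: measurable_normal_pdf].
Qed.

Lemma integrable_powr_normal_pdf k :
  leb.-integrable setT (fun x => (x ^+ k * phi x)%:E).
Proof.
have [C C0 HC] := powr_normal_pdf_le k.
have iC : leb.-integrable setT (fun x => C%:E * (normal_pdf 0 2 x)%:E)%E.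
  by apply: integrableZl => //; exact: integrable_normal_pdf.
apply: le_integrable iC => //.
  by apply/measurable_EFinP; exact: measurable_powr_normal_pdf.
move=> x _ /=; rewrite lee_fin (le_trans (HC x)) // ler_norm //.
Qed.

Let G k x : R := x ^+ k * phi x.
Let g k x : R := k%:R * (x ^+ k.-1 * phi x) - x ^+ k.+1 * phi x.

Let is_derive_G (k : nat) (x : R) : is_derive x (1 : R) (G k) (g k x).
Proof.
pose p : {poly R} := normal_peak 1 *: 'X^k; pose q : {poly R} := - 2^-1 *: 'X^2.
have -> : G k = horner p * (expR \o horner q).
  apply/funext => y; rewrite /G normal_pdf01E fctE /= /p /q !hornerZ !hornerXn.
  by rewrite mulrCA mulrA; congr (_ * expR _); rewrite mulNr mulrC mulNr.
apply: is_derive_eq; rewrite /g !normal_pdf01E /p /q /= !derivZ !derivXn !hornerE /=.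
rewrite /GRing.scale /= !hornerMn !hornerXn /= mulr2n.
have -> : - (1 + 1)^-1 * x * x = - x ^+ 2 / (1 + 1) by ring.
by rewrite (exprS x k) -(mulr_natl (x ^+ k.-1)); field.
Qed.

(** The bound for exponent [k.+1] keeps [n] times the boundary value bounded. *)
Let cvg_boundary k (s : R) : `|s| = 1 -> G k (s * n%:R) @[n --> \oo] --> (0 : R).
Proof.
move=> s1; have [C C0 HC] := powr_normal_pdf_le k.+1.
apply/cvgrPdist_le => e e0; near=> n.
have n0 : (0 : R) < n%:R by rewrite ltr0n; near: n; exact: nbhs_infty_gt.
rewrite sub0r normrN -(ler_pM2l n0).
have -> : n%:R * `|G k (s * n%:R)| = `|(s * n%:R) ^+ k.+1 * phi (s * n%:R)|.
  by rewrite /G [in RHS]exprS -[in RHS]mulrA (normrM (s * n%:R)) (normrM s) s1 mul1r normr_nat.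
apply: le_trans (HC _) _; apply: (@le_trans _ _ (C * normal_peak 2)).
  by rewrite ler_wpM2l // normal_pdf_ub.
rewrite -ler_pdivrMr //; near: n; exact: nbhs_infty_ger.
Unshelve. all: by end_near. Qed.

Let integrable_g k : leb.-integrable setT (fun x => (g k x)%:E).
Proof.
rewrite /g; under eq_fun do rewrite EFinB EFinM.
apply: integrableB => //; last exact: integrable_powr_normal_pdf.
by apply: integrableZl => //; exact: integrable_powr_normal_pdf.
Qed.

Let continuous_g k : continuous (g k).
Proof.
move=> x; apply: cvgB; last first.
  by apply: cvgM; [exact: exprn_continuous|exact: continuous_normal_pdf].
apply: cvgM; first exact: cvg_cst.
by apply: cvgM; [exact: exprn_continuous|exact: continuous_normal_pdf].
Qed.

(** [g k] is the derivative of [G k]: its integral over [-n, n] is a difference of vanishing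
    boundary values, and converges to the full integral by domination. *)
Let integral_g k : (\int[leb]_x (g k x)%:E = 0)%E.
Proof.
pose gn n := (fun x => (g k x)%:E) \_ `[- n%:R, n%:R].
have gnE n : (0 < n)%N -> (\int[leb]_x gn n x = (G k n%:R - G k (- n%:R))%:E)%E.
  move=> n0; rewrite /gn -integral_mkcond.
  rewrite (@continuous_FTC2 _ _ (G k)) //.
  - by rewrite gtrN // ltr0n.
  - exact: continuous_subspaceT.
  - have cG x : {for x, continuous (G k)}.
      by apply/differentiable_continuous/derivable1_diffP; case: (is_derive_G k x).
    split; first by move=> x _; case: (is_derive_G k x).
    + exact/cvg_at_right_filter/cG.
    + exact/cvg_at_left_filter/cG.
  - by move=> x _; rewrite derive1E; case: (is_derive_G k x).
have lim1 : (\int[leb]_x gn n x @[n --> \oo] --> \int[leb]_x (g k x)%:E)%E.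
  apply: (@dominated_cvg _ _ _ leb setT _ _ _ (fun x => `|(g k x)%:E|)%E) => //=.
  - move=> n; apply: (measurable_restrictT _ _).1 => //.
    by apply: measurable_funTS; exact: measurable_int (integrable_g k).
  - move=> x _; apply: cvg_near_cst; near=> n.
    rewrite /gn patchE ifT // inE /= in_itv /= -ler_norml.
    by near: n; exact: nbhs_infty_ger.
  - exact: (integrable_abse (integrable_g k)).
  - move=> n x _; rewrite /gn patchE; case: ifPn => // _.
    by rewrite abse0.
have lim2 : (\int[leb]_x gn n x @[n --> \oo] --> (0 : \bar R))%E.
  have : (G k n%:R - G k (- n%:R))%:E @[n --> \oo] --> ((0 - 0 : R)%:E : \bar R).
    apply: cvg_EFin; first by near=> n.
    apply: cvgB; under eq_fun do rewrite ?(mulN1r, mul1r).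
    + have := @cvg_boundary k 1 (normr1 _); by under eq_fun do rewrite mul1r.
    + have := @cvg_boundary k (-1); rewrite normrN1 => /(_ erefl).
      by under eq_fun do rewrite mulN1r.
  rewrite subr0; apply: cvg_trans; apply: near_eq_cvg; near=> n; apply/esym/gnE.
  by near: n; exact: nbhs_infty_gt.
by have := cvg_unique _ lim1 lim2; apply.
Unshelve. all: by end_near. Qed.

Lemma normal_moment_rec k : (\int[leb]_x (x ^+ k.+1 * phi x)%:E =
  k%:R%:E * \int[leb]_x (x ^+ k.-1 * phi x)%:E)%E.
Proof.
have ik := integrable_powr_normal_pdf k.+1; have ik' := integrable_powr_normal_pdf k.-1.
have := integral_g k; rewrite /g; under eq_integral do rewrite EFinB EFinM.
rewrite integralB //; last exact: integrableZl.
rewrite integralZl // => /eqP; rewrite sube_eq ?add0e; last first.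
- by rewrite fin_num_adde_defl // integrable_fin_num.
- by rewrite fin_numM // integrable_fin_num.
by move=> /eqP->.
Qed.

End GaussianMoments.

Section RealMean.
Local Open Scope classical_set_scope.
Context d (T : measurableType d) (R : realType) (P : probability T R).
Implicit Types f g : T -> R.

Definition rmean f : R := fine (\int[P]_w (f w)%:E)%E.
Definition rintegrable f : Prop := P.-integrable setT (fun w => (f w)%:E).

Lemma rmeanK f : rintegrable f -> (\int[P]_w (f w)%:E = (rmean f)%:E)%E.
Proof. by move=> fi; rewrite fineK // integrable_fin_num. Qed.

Lemma rintegrable_cst (c : R) : rintegrable (fun=> c).
Proof. exact: finite_measure_integrable_cst. Qed.

Lemma rmean_cst (c : R) : rmean (fun=> c) = c.
Proof. by have := expectation_cst P c; rewrite unlock => E; rewrite /rmean E. Qed.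

Lemma rintegrableD f g : rintegrable f -> rintegrable g ->
  rintegrable (fun w => f w + g w).
Proof.
by move=> fi gi; rewrite /rintegrable; under eq_fun do rewrite EFinD; exact: integrableD.
Qed.

Lemma rmeanD f g : rintegrable f -> rintegrable g ->
  rmean (fun w => f w + g w) = rmean f + rmean g.
Proof.
move=> fi gi; rewrite /rmean; under eq_integral do rewrite EFinD.
by rewrite integralD // fineD // integrable_fin_num.
Qed.

Lemma rintegrableZ (c : R) f : rintegrable f -> rintegrable (fun w => c * f w).
Proof.
by move=> fi; rewrite /rintegrable; under eq_fun do rewrite EFinM; exact: integrableZl.
Qed.

Lemma rmeanZ (c : R) f : rintegrable f -> rmean (fun w => c * f w) = c * rmean f.
Proof.
move=> fi; rewrite /rmean; under eq_integral do rewrite EFinM.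
by rewrite integralZl // fineM // integrable_fin_num.
Qed.

Lemma rintegrable_sum (I : Type) (r : seq I) (F : I -> T -> R) :
  (forall i, rintegrable (F i)) -> rintegrable (fun w => \sum_(i <- r) F i w).
Proof.
move=> Fi; elim: r => [|i r IH].
  by under eq_fun do rewrite big_nil; exact: rintegrable_cst.
by under eq_fun do rewrite big_cons; exact: rintegrableD.
Qed.

Lemma rmean_sum (I : Type) (r : seq I) (F : I -> T -> R) :
  (forall i, rintegrable (F i)) ->
  rmean (fun w => \sum_(i <- r) F i w) = \sum_(i <- r) rmean (F i).
Proof.
move=> Fi; elim: r => [|i r IH].
  by under eq_fun do rewrite big_nil; rewrite rmean_cst big_nil.
under eq_fun do rewrite big_cons; rewrite rmeanD // ?IH ?big_cons //.
exact: rintegrable_sum.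
Qed.

Lemma rmean_ge0 f : (forall w, 0 <= f w) -> 0 <= rmean f.
Proof. by move=> f0; apply: fine_ge0; apply: integral_ge0 => w _; rewrite lee_fin. Qed.

Lemma ge0_rintegrable f (c : R) : measurable_fun setT f -> (forall w, 0 <= f w) ->
  (\int[P]_w (f w)%:E = c%:E)%E -> rintegrable f.
Proof.
move=> mf f0 fc; apply/integrableP; split; first exact/measurable_EFinP.
by under eq_integral do rewrite /= ger0_norm //; rewrite fc ltry.
Qed.

End RealMean.

(** * Expectation of a product of independent variables *)

Section IndependentProducts.
Local Open Scope classical_set_scope.
Context d (T : measurableType d) (R : realType) (P : probability T R).
Variables (I : finType) (X : I -> {RV P >-> R}).
Hypothesis indepX : mutually_independent X.
Implicit Types f : I -> R -> R.

Let F f w : R := \prod_i f i (X i w).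
Let E f : R := \prod_i rmean P (fun w => f i (X i w)).
Let upd f k g : I -> R -> R := fun i => if i == k then g else f i.

Let updK f k : upd f k (f k) = f.
Proof. by apply/funext => i; rewrite /upd; case: eqP => // ->. Qed.

Let F_upd f k g w : F (upd f k g) w = g (X k w) * \prod_(i | i != k) f i (X i w).
Proof.
rewrite /F (bigD1 k) //= /upd eqxx; congr (_ * _).
by apply: eq_bigr => i /negbTE->.
Qed.

Let E_upd f k g :
  E (upd f k g) = rmean P (fun w => g (X k w)) * \prod_(i | i != k) rmean P (fun w => f i (X i w)).
Proof.
rewrite /E (bigD1 k) //= /upd eqxx; congr (_ * _).
by apply: eq_bigr => i /negbTE->.
Qed.

Let measurable_F f : (forall i, measurable_fun setT (f i)) -> measurable_fun setT (F f).
Proof.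
by move=> mf; apply: measurable_prod => i _; exact: measurableT_comp.
Qed.

Let integral_indicX i B : measurable B ->
  (\int[P]_w (\1_B (X i w))%:E = P (X i @^-1` B))%E.
Proof.
move=> mB.
have -> : (fun w => (\1_B (X i w))%:E : \bar R) = (fun w => (\1_(X i @^-1` B) w)%:E).
  by apply/funext => w; rewrite !indicE; congr (_%:R%:E); apply/idP/idP; rewrite !inE.
by rewrite integral_indic ?setIT // -[_ @^-1` _]setTI; exact: measurable_funP.
Qed.

(** The list [s] holds the indices whose factor may not be an indicator; if it is empty, this is
    independence of events. To treat [k], the induction hypothesis with an indicator in place of
    [f k] shows that [P] weighted by the other factors pushes forward under [X k] to the law of
    [X k] times the product [c] of the other means. *)
Let indep_ge0 (s : seq I) f : (forall i, measurable_fun setT (f i)) ->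
  (forall i x, 0 <= f i x) -> (forall i, rintegrable P (fun w => f i (X i w))) ->
  (forall i, i \notin s -> exists2 B, measurable B & f i = \1_B) ->
  (\int[P]_w (F f w)%:E = (E f)%:E)%E.
Proof.
elim: s f => [|k s IH] f mf f0 fi fB.
  pose B i := sval (cid2 (fB i isT)).
  have mB i : measurable (B i) by rewrite /B; case: cid2.
  have fE i : f i = \1_(B i) by rewrite /B; case: cid2.
  have -> : F f = \1_[set w | forall i, i \in [set: I]%SET -> B i (X i w)].
    apply/funext => w; rewrite /F indicE.
    have [wB|nwB] := pselect (forall i, i \in [set: I]%SET -> B i (X i w)).
      by rewrite mem_set // big1 // => i _; rewrite fE indicE mem_set //; apply: wB.
    rewrite memNset //; have /existsNP[i /not_implyP[_ nB]] := nwB.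
    by rewrite (bigD1 i) //= fE indicE memNset // mul0r.
  rewrite integral_indic //; last first.
    rewrite (_ : mkset _ = \bigcap_(i in [set: I]) (X i @^-1` B i)).
      apply: fin_bigcap_measurable; first exact: finite_finset.
      by move=> i _; rewrite -[_ @^-1` _]setTI; exact: measurable_funP.
    by apply/seteqP; split=> w /= wB i _; apply: wB; rewrite ?finset.inE.
  rewrite setIT [LHS](indepX [set: I]%SET mB) /E -prodEFin; apply: eq_big => [i|i _]; first by rewrite finset.inE.
  by rewrite -rmeanK // fE integral_indicX.
pose H w := \prod_(i | i != k) f i (X i w).
pose c := \prod_(i | i != k) rmean P (fun w => f i (X i w)).
have c0 : 0 <= c by apply: prodr_ge0 => i _; apply: rmean_ge0 => w.
have mH : measurable_fun setT H.
  rewrite /H; under eq_fun do rewrite -big_filter.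
  by apply: measurable_prod => i _; exact: measurableT_comp.
have H0 w : 0 <= H w by apply: prodr_ge0.
rewrite -(updK f k) E_upd -/c; under eq_integral do rewrite F_upd -/(H _).
pose nu := mscale (NngNum c0) (distribution P (X k)).
rewrite (@ge0_integral_weighted_pushforward _ _ _ _ _ P nu (X k) H) //; first last.
- move=> B mB.
  have iB : rintegrable P (fun w => \1_B (X k w)).
    apply: (@ge0_rintegrable _ _ _ _ _ (fine (P (X k @^-1` B)))) => //.
      by apply: measurableT_comp => //; exact: measurable_indic.
    rewrite fineK ?fin_num_measure //; last first.
      by rewrite -[_ @^-1` _]setTI; exact: measurable_funP.
    exact: integral_indicX.
  have := IH (upd f k \1_B); rewrite E_upd -/c => IHB.
  under eq_integral do rewrite -(F_upd _ _ \1_B).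
  rewrite IHB.
  + rewrite EFinM -rmeanK // /nu /mscale /= muleC; congr (_ * _)%E.
    exact: integral_indicX.
  + by move=> i; rewrite /upd; case: ifP => _ //; exact: measurable_indic.
  + by move=> i x; rewrite /upd; case: ifP => _.
  + by move=> i; rewrite /upd; case: eqP => // ->.
  + move=> i si; rewrite /upd; case: eqP => [_|/eqP ik]; first by exists B.
    by apply: fB; rewrite inE negb_or ik.
have mfk : measurable_fun setT (fun y => (f k y)%:E) by exact/measurable_EFinP.
rewrite ge0_integral_mscale //; last by move=> y _; rewrite lee_fin.
rewrite ge0_integral_distribution //; last by move=> y; rewrite lee_fin.
rewrite [LHS]muleC EFinM; congr (_ * _)%E.
exact: rmeanK (fi k).
Qed.

(** Now [s] holds the factors that may change sign; each is split into its positive and negative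
    parts, and both sides are linear in that factor. *)
Let indep_signed (s : seq I) f : (forall i, measurable_fun setT (f i)) ->
  (forall i, rintegrable P (fun w => f i (X i w))) ->
  (forall i, i \notin s -> forall x, 0 <= f i x) ->
  rintegrable P (F f) /\ rmean P (F f) = E f.
Proof.
elim: s f => [|k s IH] f mf fi f0.
  have I0 : (\int[P]_w (F f w)%:E = (E f)%:E)%E.
    by apply: (@indep_ge0 (enum I)) => // i; [move=> x; exact: f0|rewrite mem_enum].
  split; last by rewrite /rmean I0.
  by apply: ge0_rintegrable I0 => [|w]; [exact: measurable_F|apply: prodr_ge0 => i _; exact: f0].
pose fp x := Num.max (f k x) 0; pose fn x := Num.max (- f k x) 0.
have fE x : f k x = fp x + - 1 * fn x.
  rewrite /fp /fn mulN1r; case: (leP (f k x) 0) => h.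
    by rewrite max_l ?oppr_ge0 // opprK add0r.
  by rewrite max_r ?oppr_le0 ?ltW // subr0.
have mfp : measurable_fun setT fp by exact: measurable_funrpos.
have mfn : measurable_fun setT fn by exact: measurable_funrneg.
have ifpn (g : R -> R) : (forall x, `|g x| <= `|f k x|) -> measurable_fun setT g ->
    rintegrable P (fun w => g (X k w)).
  move=> gf mg; apply: le_integrable (fi k) => //.
    by apply/measurable_EFinP; exact: measurableT_comp.
  by move=> w _ /=; rewrite lee_fin.
have ip : rintegrable P (fun w => fp (X k w)).
  apply: ifpn => // x; rewrite /fp; case: (leP (f k x) 0) => // _.
  by rewrite normr0.
have im : rintegrable P (fun w => fn (X k w)).
  apply: ifpn => // x; rewrite /fn; case: (leP (- f k x) 0) => _; last by rewrite normrN.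
  by rewrite normr0.
have Hupd (g : R -> R) : measurable_fun setT g -> rintegrable P (fun w => g (X k w)) ->
    (forall x, 0 <= g x) -> rintegrable P (F (upd f k g)) /\ rmean P (F (upd f k g)) = E (upd f k g).
  move=> mg ig g0; apply: IH => i; rewrite /upd.
  - by case: ifP.
  - by case: eqP => // ->.
  - move=> si; case: eqP => // /eqP ik; apply: f0.
    by rewrite inE negb_or ik.
have [Ip Ep] : rintegrable P (F (upd f k fp)) /\ rmean P (F (upd f k fp)) = E (upd f k fp).
  by apply: Hupd => // x; rewrite /fp le_max lexx orbT.
have [Im Em] : rintegrable P (F (upd f k fn)) /\ rmean P (F (upd f k fn)) = E (upd f k fn).
  by apply: Hupd => // x; rewrite /fn le_max lexx orbT.
have FE : F f = fun w => F (upd f k fp) w + -1 * F (upd f k fn) w.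
  by apply/funext => w; rewrite -{1}(updK f k) !F_upd fE mulrDl mulrA.
rewrite FE; split; first by apply: rintegrableD => //; exact: rintegrableZ.
rewrite rmeanD //; last exact: rintegrableZ.
have -> : E f = rmean P (fun w => f k (X k w)) *
    \prod_(i | i != k) rmean P (fun w => f i (X i w)) by rewrite -E_upd updK.
rewrite rmeanZ // Ep Em !E_upd mulrA -mulrDl; congr (_ * _).
have -> : (fun w => f k (X k w)) = (fun w => fp (X k w) + -1 * fn (X k w)).
  by apply/funext => w; rewrite fE.
rewrite rmeanD //; last exact: rintegrableZ.
by rewrite rmeanZ.
Qed.

Lemma rmean_indep_prod f : (forall i, measurable_fun setT (f i)) ->
  (forall i, rintegrable P (fun w => f i (X i w))) ->
  rintegrable P (fun w => \prod_i f i (X i w)) /\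
  rmean P (fun w => \prod_i f i (X i w)) = \prod_i rmean P (fun w => f i (X i w)).
Proof.
by move=> mf fi; apply: (@indep_signed (enum I)) => // i; rewrite mem_enum.
Qed.

End IndependentProducts.

Section StandardNormalMoments.
Local Open Scope classical_set_scope.
Context d (T : measurableType d) (R : realType) (P : probability T R).
Local Notation leb := (@lebesgue_measure R).
Local Notation phi := (@normal_pdf R 0 1).

Definition gauss_moment (k : nat) : R := fine (\int[leb]_x (x ^+ k * phi x)%:E)%E.

Lemma gauss_momentS k : gauss_moment k.+1 = k%:R * gauss_moment k.-1.
Proof.
rewrite /gauss_moment normal_moment_rec fineM // integrable_fin_num //.
exact: integrable_powr_normal_pdf.
Qed.

Variable X : {RV P >-> R}.
Hypothesis normX : standard_normal X.

Let integral_std_normal_ge0 (f : R -> R) : measurable_fun setT f -> (forall x, 0 <= f x) ->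
  (\int[P]_w (f (X w))%:E = \int[leb]_x (f x * phi x)%:E)%E.
Proof.
move=> mf f0.
rewrite (@ge0_integral_weighted_pushforward _ _ _ _ _ leb (distribution P X) id phi) //.
- by rewrite ge0_integral_distribution //; exact/measurable_EFinP.
- exact: measurable_normal_pdf.
- exact: normal_pdf_ge0.
move=> B mB; rewrite [RHS](normX mB) /normal_prob [RHS]integral_mkcond; apply: eq_integral => x _.
by rewrite patchE indicE; case: ifPn => _; rewrite ?mul1r ?mul0r.
Qed.

Let measurable_abs_pow k : measurable_fun [set: R] (fun x : R => `|x| ^+ k).
Proof. by apply: measurable_funX; exact: normr_measurable. Qed.

Let integrable_abs_pow k : leb.-integrable setT (fun x => (`|x| ^+ k * phi x)%:E).
Proof.
apply: le_integrable (integrable_powr_normal_pdf R k) => //.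
  apply/measurable_EFinP; apply: measurable_funM; last exact: measurable_normal_pdf.
  exact: measurable_abs_pow.
by move=> x _ /=; rewrite lee_fin !normrM !normrX normr_id.
Qed.

Let abs_pow_moment k : rintegrable P (fun w => `|X w| ^+ k) /\
  (\int[P]_w (`|X w| ^+ k)%:E = \int[leb]_x (`|x| ^+ k * phi x)%:E)%E.
Proof.
have mf := measurable_abs_pow k.
have f0 (x : R) : 0 <= `|x| ^+ k by rewrite exprn_ge0.
have E := integral_std_normal_ge0 mf f0; split=> //.
have fin := integrable_fin_num measurableT (integrable_abs_pow k).
rewrite -(fineK fin) in E; apply: ge0_rintegrable E => //.
exact: measurableT_comp mf _.
Qed.

Lemma rintegrable_std_normal_pow k : rintegrable P (fun w => X w ^+ k).
Proof.
have [ai _] := abs_pow_moment k; apply: le_integrable ai => //.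
  apply/measurable_EFinP; exact: measurable_funX.
by move=> w _ /=; rewrite lee_fin normrX [leRHS]ger0_norm // exprn_ge0.
Qed.

(** The change of variables is available for nonnegative functions only; it is applied to x^k +
    |x|^k, and the finite absolute moment is subtracted. *)
Lemma rmean_std_normal_pow k : rmean P (fun w => X w ^+ k) = gauss_moment k.
Proof.
have [ai aE] := abs_pow_moment k; have xi := rintegrable_std_normal_pow k.
have lxi := integrable_powr_normal_pdf R k; have lai := integrable_abs_pow k.
have E : (\int[P]_w (X w ^+ k + `|X w| ^+ k)%:E =
    \int[leb]_x ((x ^+ k + `|x| ^+ k) * phi x)%:E)%E.
  apply: (@integral_std_normal_ge0 (fun x => x ^+ k + `|x| ^+ k)).
    by apply: measurable_funD; [exact: measurable_funX|exact: measurable_abs_pow].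
  by move=> x; rewrite -normrX -lerBlDr sub0r lerNnormlW.
move: E; under eq_integral do rewrite EFinD.
under [in RHS]eq_integral do rewrite mulrDl EFinD.
rewrite !integralD // aE => E.
have f1 := integrable_fin_num measurableT xi.
have f2 := integrable_fin_num measurableT lai.
have f3 := integrable_fin_num measurableT lxi.
have := congr1 fine E; rewrite (fineD f1 f2) (fineD f3 f2) => E'.
exact: addIr E'.
Qed.

End StandardNormalMoments.

(** * Gaussian integration by parts for polynomials *)

Section MonomialCalculus.
Context (T : Type) (R : comNzRingType) (I : finType) (X : I -> T -> R).
Implicit Types (e : I -> nat) (F : T -> R) (DF : I -> T -> R).

Definition monomial_fun e w : R := \prod_i X i w ^+ e i.
Definition monomial_deriv e a w : R :=
  (e a)%:R * X a w ^+ (e a).-1 * \prod_(i | i != a) X i w ^+ e i.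

(* [F] is a polynomial in the [X i], and [DF a] its formal partial derivative;
   the expansion need not be unique. *)
Definition poly_deriv F DF : Prop := exists l : seq (R * (I -> nat)),
  (forall w, F w = \sum_(x <- l) x.1 * monomial_fun x.2 w) /\
  (forall a w, DF a w = \sum_(x <- l) x.1 * monomial_deriv x.2 a w).

Lemma poly_deriv_ext F DF F' DF' : (forall w, F w = F' w) ->
  (forall a w, DF a w = DF' a w) -> poly_deriv F DF -> poly_deriv F' DF'.
Proof.
by move=> FE DE [l [lF lD]]; exists l; split=> [w|a w]; rewrite -?FE -?DE.
Qed.

Lemma poly_deriv_cst (c : R) : poly_deriv (fun=> c) (fun _ _ => 0).
Proof.
exists [:: (c, fun=> 0%N)]; split=> [w|a w]; rewrite big_seq1 /=.
  by rewrite /monomial_fun big1 ?mulr1 // => i _; rewrite expr0.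
by rewrite /monomial_deriv mulr0n !mul0r mulr0.
Qed.

Lemma poly_deriv_var b : poly_deriv (X b) (fun a _ => (a == b)%:R).
Proof.
exists [:: (1, fun i => (i == b) : nat)]; split=> [w|a w]; rewrite big_seq1 /= mul1r.
  rewrite /monomial_fun (bigD1 b) //= eqxx expr1 big1 ?mulr1 // => i /negbTE->.
  by rewrite expr0.
rewrite /monomial_deriv; case: eqVneq => [->|_]; last by rewrite mulr0n !mul0r.
by rewrite expr0 !mul1r big1 // => i /negbTE->; rewrite expr0.
Qed.

Lemma poly_derivD F DF F' DF' : poly_deriv F DF -> poly_deriv F' DF' ->
  poly_deriv (fun w => F w + F' w) (fun a w => DF a w + DF' a w).
Proof.
move=> [l [lF lD]] [l' [lF' lD']]; exists (l ++ l').
by split=> [w|a w]; rewrite big_cat /= -?lF -?lF' -?lD -?lD'.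
Qed.

Lemma monomial_funM e f w :
  monomial_fun (fun i => e i + f i)%N w = monomial_fun e w * monomial_fun f w.
Proof. by rewrite /monomial_fun -big_split /=; apply: eq_bigr => i _; rewrite exprD. Qed.

Lemma monomial_derivM e f a w : monomial_deriv (fun i => e i + f i)%N a w =
  monomial_deriv e a w * monomial_fun f w + monomial_fun e w * monomial_deriv f a w.
Proof.
rewrite /monomial_deriv /monomial_fun !(@bigD1 _ _ _ _ a xpredT) //=.
under eq_bigr do rewrite exprD.
rewrite big_split /=; set A := \prod_(i | _) _; set B := \prod_(i | _) _.
(* The predecessor of exponent 0 is 0, with coefficient 0, so vanishing exponents are treated
   apart. *)
case: (e a) => [|m]; case: (f a) => [|n] /=; rewrite ?addn0 ?add0n ?addSn ?addnS /= ?expr0.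
- by rewrite !mulr0n; ring.
- by rewrite !mulr0n exprS; ring.
- by rewrite !mulr0n exprS; ring.
- by rewrite !exprS exprD -!natr1 natrD; ring.
Qed.

Lemma poly_derivM F DF F' DF' : poly_deriv F DF -> poly_deriv F' DF' ->
  poly_deriv (fun w => F w * F' w) (fun a w => DF a w * F' w + F w * DF' a w).
Proof.
move=> [l [lF lD]] [l' [lF' lD']].
exists [seq (x.1 * y.1, fun i => (x.2 i + y.2 i)%N) | x <- l, y <- l'].
split=> [w|a w]; rewrite big_allpairs_dep /=.
  rewrite lF lF' big_distrl /=; apply: eq_bigr => x _; rewrite big_distrr /=.
  by apply: eq_bigr => y _; rewrite monomial_funM mulrACA.
rewrite lD lF lD' lF' !big_distrl -big_split /=; apply: eq_bigr => x _.
rewrite !big_distrr -big_split /=; apply: eq_bigr => y _.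
by rewrite monomial_derivM; ring.
Qed.

End MonomialCalculus.

Section GaussianIntegrationByParts.
Context d (T : measurableType d) (R : realType) (P : probability T R).
Variables (I : finType) (X : I -> {RV P >-> R}).
Hypothesis indepX : mutually_independent X.
Hypothesis normX : forall i, standard_normal (X i).

Let monomial_moment e : rintegrable P (monomial_fun X e) /\
  rmean P (monomial_fun X e) = \prod_i gauss_moment R (e i).
Proof.
have [|i|Mi Me] := @rmean_indep_prod _ _ _ P I X indepX (fun i x => x ^+ e i).
- by move=> i; exact: measurable_funX.
- exact: rintegrable_std_normal_pow.
split=> //; rewrite [LHS]Me; apply: eq_bigr => i _; exact: rmean_std_normal_pow.
Qed.

Let inc a e : I -> nat := fun i => if i == a then (e a).+1 else e i.
Let dec a e : I -> nat := fun i => if i == a then (e a).-1 else e i.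

Let monomial_inc a e w : X a w * monomial_fun X e w = monomial_fun X (inc a e) w.
Proof.
rewrite /monomial_fun !(@bigD1 _ _ _ _ a xpredT) //= /inc eqxx exprS mulrA; congr (_ * _).
by apply: eq_bigr => i /negbTE->.
Qed.

Let monomial_dec a e w :
  monomial_deriv X e a w = (e a)%:R * monomial_fun X (dec a e) w.
Proof.
rewrite /monomial_deriv /monomial_fun (@bigD1 _ _ _ _ a xpredT) //= /dec eqxx mulrA; congr (_ * _).
by apply: eq_bigr => i /negbTE->.
Qed.

Lemma poly_deriv_rintegrable F DF : poly_deriv X F DF ->
  rintegrable P F /\ (forall a, rintegrable P (DF a)).
Proof.
move=> [l [lF lD]]; split=> [|a].
  have -> : F = fun w => \sum_(x <- l) x.1 * monomial_fun X x.2 w by apply/funext.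
  by apply: rintegrable_sum => x; apply: rintegrableZ; case: (monomial_moment x.2).
have -> : DF a = fun w => \sum_(x <- l) x.1 * ((x.2 a)%:R * monomial_fun X (dec a x.2) w).
  by apply/funext => w; rewrite lD; apply: eq_bigr => x _; rewrite monomial_dec.
apply: rintegrable_sum => x; do 2 apply: rintegrableZ.
by case: (monomial_moment (dec a x.2)).
Qed.

(** By linearity it suffices to treat a monomial. Its moment is a product over the variables, and in
    the factor of index [a] the claim is the recursion [gauss_momentS]. *)
Lemma gaussian_integration_by_parts F DF a : poly_deriv X F DF ->
  rmean P (fun w => X a w * F w) = rmean P (DF a).
Proof.
move=> [l [lF lD]].
have -> : (fun w => X a w * F w) = fun w => \sum_(x <- l) x.1 * monomial_fun X (inc a x.2) w.
  apply/funext => w; rewrite lF big_distrr /=; apply: eq_bigr => x _.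
  by rewrite mulrCA monomial_inc.
have -> : DF a = fun w => \sum_(x <- l) x.1 * ((x.2 a)%:R * monomial_fun X (dec a x.2) w).
  by apply/funext => w; rewrite lD; apply: eq_bigr => x _; rewrite monomial_dec.
have mi e : rintegrable P (monomial_fun X e) by case: (monomial_moment e).
rewrite !rmean_sum; [|by move=> x; do 2?apply: rintegrableZ..].
apply: eq_bigr => x _; rewrite !rmeanZ //; last exact: rintegrableZ.
congr (_ * _); have [_ ->] := monomial_moment (inc a x.2).
have [_ ->] := monomial_moment (dec a x.2).
rewrite !(@bigD1 _ _ _ _ a xpredT) //= /inc /dec eqxx gauss_momentS mulrA; congr (_ * _).
by apply: eq_bigr => i /negbTE->.
Qed.

End GaussianIntegrationByParts.

(** * The loop equation of the GOE *)

Section GOELoopEquation.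
Context d (T : measurableType d) (R : realType) (P : probability T R).
Variables (N : nat) (G : 'I_N -> 'I_N -> {RV P >-> R}).
Hypothesis N_gt0 : (0 < N)%N.
Hypothesis iidG : iid_standard_normal_entries G.

Let g (ij : 'I_N * 'I_N) : {RV P >-> R} := G ij.1 ij.2.
Let s : R := (Num.sqrt (2 * N%:R))^-1.
Let u : R := N%:R^-1.
Local Notation X := (goe_matrix G).

Let s2 : s * s *+ 2 = u.
Proof.
have N0 : (0 : R) < N%:R by rewrite ltr0n.
rewrite /s -invfM -expr2 sqr_sqrtr ?mulr_ge0 //.
by rewrite /u; field; rewrite gt_eqF.
Qed.

Let XE i j w : X w i j = s * (g (i, j) w + g (j, i) w).
Proof. by rewrite !mxE. Qed.

Let X_sym n w : (X w ^+ n)^T = X w ^+ n.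
Proof.
have X1 : (X w)^T = X w by apply/matrixP => i j; rewrite mxE !XE addrC.
elim: n => [|n IH]; first exact: trmx1.
by rewrite {1}exprS exprSr [LHS]trmx_mul X1 IH.
Qed.

(* Derivative of [F] along the covariance of [X i j], so that Gaussian
   integration by parts reads [E (X i j * F) = E (DF i j)]. *)
Definition goe_deriv (F : T -> R) (DF : 'I_N -> 'I_N -> T -> R) : Prop :=
  exists2 D, poly_deriv (fun ij => g ij : T -> R) F D &
    forall i j w, DF i j w = s * (D (i, j) w + D (j, i) w).

Lemma goe_deriv_ext F DF F' DF' : (forall w, F w = F' w) ->
  (forall i j w, DF i j w = DF' i j w) -> goe_deriv F DF -> goe_deriv F' DF'.
Proof.
move=> FE DE [D FD DD]; exists D; first exact: poly_deriv_ext FD.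
by move=> i j w; rewrite -DE.
Qed.

Lemma goe_deriv_cst (c : R) : goe_deriv (fun=> c) (fun _ _ _ => 0).
Proof.
by exists (fun _ _ => 0); [exact: poly_deriv_cst|move=> i j w; rewrite addr0 mulr0].
Qed.

Lemma goe_derivD F DF F' DF' : goe_deriv F DF -> goe_deriv F' DF' ->
  goe_deriv (fun w => F w + F' w) (fun i j w => DF i j w + DF' i j w).
Proof.
move=> [D FD DD] [D' FD' DD']; exists (fun a w => D a w + D' a w).
  exact: poly_derivD.
by move=> i j w; rewrite DD DD'; ring.
Qed.

Lemma goe_derivM F DF F' DF' : goe_deriv F DF -> goe_deriv F' DF' ->
  goe_deriv (fun w => F w * F' w) (fun i j w => DF i j w * F' w + F w * DF' i j w).
Proof.
move=> [D FD DD] [D' FD' DD']; exists (fun a w => D a w * F' w + F w * D' a w).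
  exact: poly_derivM.
by move=> i j w; rewrite DD DD'; ring.
Qed.

Lemma goe_derivZ (c : R) F DF : goe_deriv F DF ->
  goe_deriv (fun w => c * F w) (fun i j w => c * DF i j w).
Proof.
move=> HF; apply: goe_deriv_ext (goe_derivM (goe_deriv_cst c) HF) => //= i j w.
by rewrite mul0r add0r.
Qed.

Lemma goe_deriv_sum (I : Type) (r : seq I) (F : I -> T -> R)
    (DF : I -> 'I_N -> 'I_N -> T -> R) : (forall k, goe_deriv (F k) (DF k)) ->
  goe_deriv (fun w => \sum_(k <- r) F k w) (fun i j w => \sum_(k <- r) DF k i j w).
Proof.
move=> HF; elim: r => [|k r IH].
  by apply: goe_deriv_ext (goe_deriv_cst 0) => *; rewrite big_nil.
by apply: goe_deriv_ext (goe_derivD (HF k) IH) => *; rewrite big_cons.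
Qed.

(** The entry [k l] is the covariance of [X i j] and [X k l]. *)
Let U i j : 'M[R]_N := u *: (delta_mx i j + delta_mx j i).

Lemma goe_deriv_entry k l : goe_deriv (fun w => X w k l) (fun i j _ => U i j k l).
Proof.
have gd := poly_deriv_var (fun ij => g ij : T -> R).
have := poly_derivM (poly_deriv_cst _ s) (poly_derivD (gd (k, l)) (gd (l, k))).
set D := (D in poly_deriv _ _ D) => HD; exists D.
  by apply: poly_deriv_ext HD => // w; rewrite XE.
move=> i j w; rewrite /D !mxE !xpair_eqE !mul0r !add0r -s2.
rewrite (eq_sym k i) (eq_sym l j) (eq_sym k j) (eq_sym l i) (andbC (j == k)) (andbC (j == l)).
ring.
Qed.

Lemma goe_deriv_rintegrable F DF : goe_deriv F DF ->
  rintegrable P F /\ forall i j, rintegrable P (DF i j).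
Proof.
move=> [D FD DD]; have [Fi Di] := poly_deriv_rintegrable iidG.1 (fun a => iidG.2 a.1 a.2) FD.
split=> // i j; have -> : DF i j = fun w => s * (D (i, j) w + D (j, i) w) by apply/funext.
by apply: rintegrableZ; apply: rintegrableD.
Qed.

Lemma goe_integration_by_parts F DF i j : goe_deriv F DF ->
  rmean P (fun w => X w i j * F w) = rmean P (DF i j).
Proof.
move=> HF; case: (HF) => D FD DD; have nG a := iidG.2 a.1 a.2.
have ibp a := gaussian_integration_by_parts iidG.1 nG a FD.
have [_ Di] := poly_deriv_rintegrable iidG.1 nG FD.
have gi a : rintegrable P (fun w => g a w * F w).
  by have [] := poly_deriv_rintegrable iidG.1 nG
    (poly_derivM (poly_deriv_var (fun ij => g ij : T -> R) a) FD).
have -> : (fun w => X w i j * F w) = fun w => s * (g (i, j) w * F w + g (j, i) w * F w).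
  by apply/funext => w; rewrite XE -mulrDl mulrA.
have -> : DF i j = fun w => s * (D (i, j) w + D (j, i) w) by apply/funext.
rewrite !rmeanZ //; try exact: rintegrableD.
by rewrite !rmeanD // !ibp.
Qed.

Lemma goe_deriv_pow n k l : goe_deriv (fun w => (X w ^+ n) k l)
  (fun i j w => \sum_(m < n) (X w ^+ m *m U i j *m X w ^+ (n.-1 - m)) k l).
Proof.
elim: n k l => [|n IH] k l.
  by apply: goe_deriv_ext (goe_deriv_cst ((1 : 'M[R]_N) k l)) => *; rewrite ?big_ord0.
have := goe_deriv_sum (index_enum 'I_N) (fun p => goe_derivM (IH k p) (goe_deriv_entry p l)).
apply: goe_deriv_ext => [w|i j w]; first by rewrite exprSr mxE.
rewrite big_split big_ord_recr /= subnn expr0 mulmx1; congr (_ + _); last by rewrite mxE.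
under eq_bigr do rewrite big_distrl /=.
rewrite exchange_big /=; apply: eq_bigr => m _.
have -> : (n - m = (n.-1 - m).+1)%N by have := ltn_ord m; lia.
by rewrite exprSr -[_ * X w]/(_ *m X w) mulmxA [RHS]mxE.
Qed.

Let mul_delta_entry (A B : 'M[R]_N) i j k l :
  (A *m delta_mx i j *m B) k l = A k i * B j l.
Proof.
rewrite -mulmxA mxE (bigD1 i) //= big1 ?addr0 => [|p pi]; last first.
  by rewrite mxE big1 ?mulr0 // => q _; rewrite mxE (negbTE pi) mul0r.
congr (_ * _); rewrite mxE (bigD1 j) //= big1 ?addr0 => [|q qj].
  by rewrite mxE !eqxx mul1r.
by rewrite mxE (negbTE qj) andbF mul0r.
Qed.

Let mulU_entry (A B : 'M[R]_N) i j k l :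
  (A *m U i j *m B) k l = u * (A k i * B j l + A k j * B i l).
Proof.
by rewrite /U -scalemxAr -scalemxAl mulmxDr mulmxDl mxE [X in u * X]mxE !mul_delta_entry.
Qed.

Definition goe_trace n w : R := normalized_trace (X w ^+ n).

(** One factor [u] is the normalisation of the trace, the other the covariance. By cyclicity all [n]
    positions contribute equally, and the two halves of [U] agree because powers of [X] are
    symmetric, whence the 2. *)
Lemma goe_deriv_trace n : goe_deriv (goe_trace n)
  (fun i j w => 2 * u ^+ 2 * n%:R * (X w ^+ n.-1) i j).
Proof.
have := goe_derivZ u (goe_deriv_sum (index_enum 'I_N) (fun k => goe_deriv_pow n k k)).
apply: goe_deriv_ext => [w|i j w]; first by [].
rewrite exchange_big /= (eq_bigr (fun=> 2 * u * (X w ^+ n.-1) i j)); last first.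
  move=> m _; under eq_bigr do rewrite mulU_entry.
  rewrite -big_distrr big_split /=.
  have tr (A B : 'M[R]_N) p q : \sum_(k < N) A k p * B q k = (B *m A) q p.
    by rewrite mxE; apply: eq_bigr => k _; rewrite mulrC.
  rewrite !tr -![_ *m _]/(_ * _) -exprD subnK; last by have := ltn_ord m; lia.
  have -> : (X w ^+ n.-1) j i = (X w ^+ n.-1) i j by rewrite -{1}X_sym mxE.
  ring.
by rewrite sumr_const card_ord -mulr_natl; ring.
Qed.

Definition goe_traces (l : seq nat) w : R := \prod_(m <- l) goe_trace m w.

Fixpoint goe_traces_deriv (l : seq nat) i j w : R :=
  if l is m :: l' then
    2 * u ^+ 2 * m%:R * (X w ^+ m.-1) i j * goe_traces l' w +
    goe_trace m w * goe_traces_deriv l' i j w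
  else 0.

Lemma goe_deriv_traces l : goe_deriv (goe_traces l) (goe_traces_deriv l).
Proof.
elim: l => [|m l IH].
  by apply: goe_deriv_ext (goe_deriv_cst 1) => // w; rewrite /goe_traces big_nil.
apply: goe_deriv_ext (goe_derivM (goe_deriv_trace m) IH) => // w.
by rewrite /goe_traces big_cons.
Qed.

(** Pairing an entry of the leading trace with one of a trace of degree [m] merges the two into a
    single trace of degree [n + m - 1]; this happens in [m] positions. *)
Lemma goe_traces_contract n l w :
  u * \sum_i \sum_j (X w ^+ n) j i * goe_traces_deriv l i j w =
  2 * u ^+ 2 * \sum_(x <- trace_contractions n l) x.1%:R * goe_traces x.2 w.
Proof.
elim: l => [|m l IH] /=.
  by rewrite big_nil mulr0 big1 ?mulr0 // => i _; rewrite big1 // => j _; rewrite mulr0.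
rewrite big_cons big_map /=.
transitivity (2 * u ^+ 2 * m%:R * goe_traces l w * (u * \sum_i \sum_j (X w ^+ n) j i * (X w ^+ m.-1) i j)
  + goe_trace m w * (u * \sum_i \sum_j (X w ^+ n) j i * goe_traces_deriv l i j w)).
  rewrite [in RHS]mulrCA [X in _ + X]mulrCA -mulrDr; congr (_ * _).
  rewrite !big_distrr -big_split /=; apply: eq_bigr => i _.
  by rewrite !big_distrr -big_split /=; apply: eq_bigr => j _; ring.
rewrite IH mulrDr; congr (_ + _); last first.
  rewrite mulrCA; congr (_ * _); rewrite big_distrr /=; apply: eq_bigr => x _.
  by rewrite /goe_traces big_cons mulrCA.
(* For [m = 0] the truncated exponents carry no meaning, but the multiplicity 0 annihilates both
   sides. *)
case: m => [|m]; first by rewrite !mulr0n !mul0r !mulr0 !mul0r.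
rewrite /goe_traces big_cons addnS /= -/(goe_traces l w).
have -> : u * \sum_i \sum_j (X w ^+ n) j i * (X w ^+ m) i j = goe_trace (n + m) w.
  rewrite /goe_trace /normalized_trace exchange_big /= exprD; congr (_ * _).
  by apply: eq_bigr => j _; rewrite mxE.
by rewrite -/(goe_traces l w); ring.
Qed.

(** Of the two halves of [U], one cuts the cycle into two traces. The other reverses one arc, which
    by symmetry of the powers leaves the single trace of degree [n - 1] with an extra factor 1 / N,
    once for each of the [n] positions. *)
Lemma goe_pow_contract n w :
  u * \sum_i \sum_j \sum_(m < n) (X w ^+ m *m U i j *m X w ^+ (n.-1 - m)) j i =
  \sum_(m < n) goe_trace m w * goe_trace (n.-1 - m) w + n%:R * u * goe_trace n.-1 w.
Proof.
have -> : n%:R * u * goe_trace n.-1 w = \sum_(m < n) u * goe_trace n.-1 w.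
  by rewrite sumr_const card_ord -[RHS]mulr_natl mulrA.
rewrite -big_split /=; under eq_bigr do rewrite exchange_big.
rewrite exchange_big big_distrr /=; apply: eq_bigr => m _.
set A := X w ^+ m; set B := X w ^+ (n.-1 - m).
have H i : \sum_j (A *m U i j *m B) j i =
    u * (\sum_j A j i * B j i) + u * (\tr A * B i i).
  rewrite big_distrl !big_distrr -big_split /=; apply: eq_bigr => j _.
  by rewrite mulU_entry mulrDr.
rewrite (eq_bigr _ (fun i _ => H i)) big_split -!big_distrr /= addrC mulrDr; congr (_ + _).
  by rewrite /goe_trace /normalized_trace -/u -/A -/B -/(\tr B); ring.
rewrite /goe_trace /normalized_trace -/u; congr (_ * (_ * _)).
have -> : X w ^+ n.-1 = A *m B.
  by rewrite -[_ *m _]/(_ * _) -exprD subnKC //; have := ltn_ord m; lia.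
rewrite exchange_big /=; apply: eq_bigr => j _; rewrite mxE; apply: eq_bigr => i _.
by congr (_ * _); rewrite /B -{1}X_sym mxE.
Qed.

Definition goe_loop_moment (l : seq nat) : R := rmean P (goe_traces l).

Lemma rintegrable_goe_traces l : rintegrable P (goe_traces l).
Proof. by case: (goe_deriv_rintegrable (goe_deriv_traces l)). Qed.

Lemma goe_loop_moment_nil : goe_loop_moment [::] = 1.
Proof.
rewrite /goe_loop_moment -[RHS](rmean_cst P); congr rmean.
by apply/funext => w; rewrite /goe_traces big_nil.
Qed.

Lemma goe_loop_moment0 l : goe_loop_moment (0%N :: l) = goe_loop_moment l.
Proof.
rewrite /goe_loop_moment; congr rmean; apply/funext => w.
rewrite /goe_traces big_cons /goe_trace /normalized_trace expr0.
by rewrite [\tr _]mxtrace1 mulVf ?mul1r // pnatr_eq0 -lt0n.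
Qed.

(** One factor [X i j] is detached from the leading trace and integrated by parts. The derivative
    falls either on the remaining power, treated by [goe_pow_contract], or on the other traces,
    treated by [goe_traces_contract]. *)
Lemma goe_loop_equation n l : goe_loop_moment (n.+1 :: l) =
  \sum_(k < n) goe_loop_moment ((k : nat) :: (n.-1 - k)%N :: l) +
  n%:R / N%:R * goe_loop_moment (n.-1 :: l) +
  2 * N%:R^-1 ^+ 2 * \sum_(x <- trace_contractions n l) x.1%:R * goe_loop_moment x.2.
Proof.
pose F i j w := (X w ^+ n) j i * goe_traces l w.
pose DF i j w := (\sum_(m < n) (X w ^+ m *m U i j *m X w ^+ (n.-1 - m)) j i) * goe_traces l w +
  (X w ^+ n) j i * goe_traces_deriv l i j w.
have HF i j : goe_deriv (F i j) (fun i' j' w =>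
    (\sum_(m < n) (X w ^+ m *m U i' j' *m X w ^+ (n.-1 - m)) j i) * goe_traces l w +
    (X w ^+ n) j i * goe_traces_deriv l i' j' w).
  exact: goe_derivM (goe_deriv_pow n j i) (goe_deriv_traces l).
have ibp i j : rmean P (fun w => X w i j * F i j w) = rmean P (DF i j).
  exact: goe_integration_by_parts (HF i j).
have DFi i j : rintegrable P (DF i j) by have [_] := goe_deriv_rintegrable (HF i j); apply.
have Fi i j : rintegrable P (fun w => X w i j * F i j w).
  by have [] := goe_deriv_rintegrable (goe_derivM (goe_deriv_entry i j) (HF i j)).
have E1 : goe_loop_moment (n.+1 :: l) = rmean P (fun w => u * \sum_i \sum_j DF i j w).
  transitivity (rmean P (fun w => u * \sum_i \sum_j X w i j * F i j w)).
    congr rmean; apply/funext => w; rewrite /goe_traces big_cons -/(goe_traces l w).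
    rewrite /goe_trace /normalized_trace -/u -mulrA; congr (_ * _).
    rewrite exprS /mxtrace big_distrl /=; apply: eq_bigr => i _.
    by rewrite mxE big_distrl /=; apply: eq_bigr => j _; rewrite mulrA.
  have Si (H : 'I_N -> 'I_N -> T -> R) : (forall i j, rintegrable P (H i j)) ->
      rmean P (fun w => u * \sum_i \sum_j H i j w) = u * \sum_i \sum_j rmean P (H i j).
    move=> Hi; have Hi' i : rintegrable P (fun w => \sum_j H i j w) by exact: rintegrable_sum.
    rewrite rmeanZ; last exact: rintegrable_sum.
    by rewrite rmean_sum //; congr (_ * _); apply: eq_bigr => i _; rewrite rmean_sum.
  rewrite !Si //; congr (_ * _).
  by apply: eq_bigr => i _; apply: eq_bigr => j _.
have E2 : (fun w => u * \sum_i \sum_j DF i j w) = fun w =>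
    \sum_(k < n) goe_traces ((k : nat) :: (n.-1 - k)%N :: l) w +
    n%:R / N%:R * goe_traces (n.-1 :: l) w +
    2 * N%:R^-1 ^+ 2 * \sum_(x <- trace_contractions n l) x.1%:R * goe_traces x.2 w.
  apply/funext => w; rewrite -/u -goe_traces_contract /DF.
  under eq_bigr do rewrite big_split /=.
  rewrite big_split mulrDr /=; congr (_ + _).
  under eq_bigr do rewrite -big_distrl /=.
  rewrite -big_distrl /= mulrA goe_pow_contract mulrDl; congr (_ + _).
    rewrite big_distrl /=; apply: eq_bigr => k _.
    by rewrite /goe_traces !big_cons mulrA.
  by rewrite /goe_traces big_cons [RHS]mulrA.
have ti := rintegrable_goe_traces.
have i1 : rintegrable P (fun w => \sum_(k < n) goe_traces ((k : nat) :: (n.-1 - k)%N :: l) w).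
  apply: (@rintegrable_sum _ _ _ P _ _
    (fun (k : 'I_n) w => goe_traces ((k : nat) :: (n.-1 - k)%N :: l) w)) => k; exact: ti.
have i2 : rintegrable P (fun w => n%:R / N%:R * goe_traces (n.-1 :: l) w).
  exact: rintegrableZ.
have i3 : rintegrable P (fun w => \sum_(x <- trace_contractions n l) x.1%:R * goe_traces x.2 w).
  by apply: rintegrable_sum => x; apply: rintegrableZ.
rewrite E1 E2 rmeanD; [|exact: rintegrableD|exact: rintegrableZ].
rewrite rmeanD // !rmeanZ // !rmean_sum //; last by move=> x; apply: rintegrableZ.
by congr (_ + _ * _); apply: eq_bigr => x _; rewrite rmeanZ.
Qed.

Lemma goe_mean_traceE n : goe_mean_trace G n = goe_loop_moment [:: n].
Proof.
rewrite /goe_mean_trace unlock /goe_loop_moment /rmean; congr (fine _).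
by apply: eq_integral => w _; rewrite /goe_traces big_seq1.
Qed.

End GOELoopEquation.

Local Open Scope classical_set_scope.

Theorem theorem25 (R : realType) (d : nat -> measure_display)
    (T : forall N : nat, measurableType (d N))
    (P : forall N : nat, probability (T N) R)
    (G : forall N : nat, 'I_N -> 'I_N -> {RV (P N) >-> R})
    (kappa kappa' : nat -> R) :
  (forall N : nat, iid_standard_normal_entries (G N)) ->
  free_cumulants (goe_moment G) kappa ->
  infinitesimal_free_cumulants (goe_inf_moment G) kappa kappa' ->
  forall n : nat, (2 <= n)%N -> ~~ odd n -> kappa' n = 1.
Proof.
move=> iidG freeK infK.
pose M N l := goe_loop_moment (G N) l.
have Mnil N : (0 < N)%N -> M N [::] = 1 by move=> _; exact: goe_loop_moment_nil.
have M0 N l : (0 < N)%N -> M N (0%N :: l) = M N l by move=> N0; exact: goe_loop_moment0.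
have Mloop N n l (N0 : (0 < N)%N) := goe_loop_equation N0 (iidG N) n l.
have mE n : goe_moment G n = semicircle_moment R n.
  rewrite -(loop_moment Mnil M0 Mloop n) /goe_moment; congr (limn _).
  by apply/funext => N; exact: goe_mean_traceE.
have m'E n : goe_inf_moment G n = semicircle_inf_moment R n.
  rewrite -(loop_inf_moment Mnil M0 Mloop n) /goe_inf_moment mE; congr (limn _).
  by apply/funext => N; rewrite goe_mean_traceE.
apply: (@semicircle_inf_cumulants R kappa kappa') => n n0.
  by rewrite -mE; exact: freeK.
by rewrite -m'E; exact: infK.
Qed.
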